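(* For each $T\in\{DPO,SPO_A,SPO_B,SPO_{AB}\}$, the reduction morphism $\bar\varphi_T:\mathcal D\to\mathcal R_T$ is an algebra homomorphism, i.e. $\bar\varphi_T(d_1*_{\mathcal D}d_2)=\bar\varphi_T(d_1)*_{\mathcal R_T}\bar\varphi_T(d_2)$ for all $d_1,d_2\in\mathcal D$; and the rule algebra $\mathcal R_T=(\mathrm{Irr}(\mathcal D),+,\cdot,*_{\mathcal R_T})$ is an associative unital $\mathbb K$-algebra with unit $d_\emptyset$.
   Context: $\mathbb K$ is a field (such as $\mathbb R$ or $\mathbb C$). Relations. For finite sets $A,B$ a relation is a subset $R\subseteq A\times B$; $S\circ R=\{(a,c)\mid \exists b:(a,b)\in R,(b,c)\in S\}$; $R^{-1}=\{(b,a)\mid (a,b)\in R\}$ is the converse; for a relation $R$ on one set, $R^*$ is its reflexive transitive closure. $R$ is one-to-one if distinct pairs in $R$ differ in both entries. Graphs and linear rules. A graph is a finite directed multigraph $G=(V_G,E_G,s_G,t_G)$ (loops allowed). A linear rule $r:I\rightharpoonup O$ is an injective partial graph morphism: a pair of one-to-one relations $r\subseteq (V_I\times V_O)\uplus(E_I\times E_O)$ such that for edges $(e,e')\in r$ implies $(s(e),s(e')),(t(e),t(e'))\in r$. It is connected if it is not empty and is not a disjoint union of two non-empty rules. Rule diagrams. A rule diagram $\mathfrak d=(I,O,r,m,s,t)$ consists of graphs $I=\biguplus_{i=1}^n I_i$, $O=\biguplus_{i=1}^n O_i$ (with $s,t$ the source and target maps of $I\uplus O$), $r=\biguplus_i r_i$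 with each $r_i:I_i\rightharpoonup O_i$ a connected linear rule, and a one-to-one relation $m=\biguplus_{i<j}m_{i,j}$, where $m_{i,j}\subseteq (V_{O_j}\times V_{I_i})\uplus(E_{O_j}\times E_{I_i})$, such that with $\omega_m:=m\circ(r\circ m)^*$: for all edges, $(e,e')\in\omega_m$ implies $(s(e),s(e')),(t(e),t(e'))\in\omega_m$. The numbering of constituents is not part of the data; $\mathfrak d_\emptyset$ is the empty rule diagram ($n=0$). Isomorphisms are pairs of graph isomorphisms $i_I:I\to I'$, $i_O:O\to O'$ with $r'=i_O r i_I^{-1}$, $m'=i_I m i_O^{-1}$. $\mathcal D$ is the $\mathbb K$-vector space with basis the set $\mathfrak D$ of isomorphism classes of rule diagrams; $d_\emptyset$ is the basis vector of $\mathfrak d_\emptyset$. The bilinear composition on $\mathcal D$ is $\mathfrak d_A*_{\mathcal D}\mathfrak d_B=\sum_{m_{AB}}(I_A\uplus I_B,O_A\uplus O_B,r_A\uplus r_B,m_A\uplus m_{AB}\uplus m_B,s_A\uplus s_B,t_A\uplus t_B)$, the sum being over all one-to-one relations $m_{AB}$ from $O_B$ to $I_A$ (vertices to vertices, edges to edges; $m_{AB}=\emptyset$ allowed) for which the displayed tuple is a rule diagram. Irreducible diagrams. $\mathrm{Irr}(\mathcal D)\subseteq\mathcal D$ is the span of the rule diagrams with $m=\emptyset$ (equivalently, of isomorphism classes of linear rules $r:I\rightharpoonup O$). $\psi:\mathrm{Irr}(\mathcal D)\hookrightarrow\mathcal D$ is the inclusion. An irreducible pre-diagram is a tuple $(I,O,r,\emptyset,s,t)$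 defined likewise except that $s,t$ may be only partially defined on edges; their span is $\mathrm{Irr}_{pre}(\mathcal D)\supseteq\mathrm{Irr}(\mathcal D)$. An edge on which $s$ or $t$ is undefined is called dangling. Boundary map. For $\mathfrak d=(I,O,r,m,s,t)$ let $\mathcal I(\mathfrak d)$ be the vertices and edges of $I$ not in the image of $m$, and $\mathcal O(\mathfrak d)$ those of $O$ not in the domain of $m$. Then $\partial(\mathfrak d):=(\mathcal I(\mathfrak d),\mathcal O(\mathfrak d),\partial r,\emptyset,\partial s,\partial t)$, where $\partial r$ is the restriction of $r\circ(m\circ r)^*$ to $\mathcal I(\mathfrak d)\times\mathcal O(\mathfrak d)$; for an edge $e\in\mathcal I(\mathfrak d)$, $\partial s(e)$ is the vertex $v\in\mathcal I(\mathfrak d)$ with $(s(e),v)\in(r^{-1}\circ m^{-1})^*$ if it exists (otherwise undefined); for an edge $e\in\mathcal O(\mathfrak d)$, $\partial s(e)$ is the vertex $v\in\mathcal O(\mathfrak d)$ with $(s(e),v)\in(r\circ m)^*$ if it exists; similarly $\partial t$. $\partial:\mathcal D\to \mathrm{Irr}_{pre}(\mathcal D)$ is extended linearly. Reduction. $f_{SPO_A}$ deletes all dangling edges of $O$ from a pre-diagram (restricting $r,s,t$ accordingly); $f_{SPO_B}$ deletes all dangling edges of $I$ (restricting $r,s,t$); $\mathcal P:\mathrm{Irr}_{pre}(\mathcal D)\to\mathrm{Irr}(\mathcal D)$ is the identity on basis pre-diagrams without dangling edges and sends all other basis pre-diagrams to $0$; all are extended linearly. $\mathcal F_{DPO}=\mathcal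 P$, $\mathcal F_{SPO_A}=\mathcal P\circ f_{SPO_A}$, $\mathcal F_{SPO_B}=\mathcal P\circ f_{SPO_B}$, $\mathcal F_{SPO_{AB}}=\mathcal P\circ f_{SPO_A}\circ f_{SPO_B}$. The reduction morphism is $\bar\varphi_T:=\mathcal F_T\circ\partial$, and the rule algebra $\mathcal R_T$ is $\mathrm{Irr}(\mathcal D)$ with the product $r_1*_{\mathcal R_T}r_2:=\bar\varphi_T(\psi(r_1)*_{\mathcal D}\psi(r_2))$. *)

(* Defs.v *)
From HB Require Import structures.
From mathcomp Require Import all_boot all_order all_algebra.
From mathcomp Require Import finmap generic_quotient boolp monalg.

Set Implicit Arguments.
Unset Strict Implicit.
Unset Printing Implicit Defensive.

Import GRing.Theory.

Local Open Scope ring_scope.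
Local Open Scope quotient_scope.

Section Relations.
Variables A B C : finType.

(* The right factor acts first. *)
Definition rcomp (S : {set B * C}) (R : {set A * B}) : {set A * C} :=
  [set p | [exists b, ((p.1, b) \in R) && ((b, p.2) \in S)]].

Definition rconv (R : {set A * B}) : {set B * A} :=
  [set p | (p.2, p.1) \in R].

Definition rstar (R : {set A * A}) : {set A * A} :=
  [set p | connect (fun x y => (x, y) \in R) p.1 p.2].

Definition one_to_one (R : {set A * B}) : Prop :=
  forall p q, p \in R -> q \in R -> p <> q -> p.1 <> q.1 /\ p.2 <> q.2.

Definition rdom (R : {set A * B}) : {set A} := [set p.1 | p in R].
Definition rim (R : {set A * B}) : {set B} := [set p.2 | p in R].

End Relations.

Definition pull (A B A' B' : finType) (f : A' -> A) (g : B' -> B)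
    (R : {set A * B}) : {set A' * B'} :=
  [set p | (f p.1, g p.2) \in R].

(* [R \uplus X \uplus S] on disjoint unions, where [X] goes from the right
   summand of the source to the left summand of the target. *)
Definition rblock (A1 B1 A2 B2 : finType) (R : {set A1 * B1})
    (X : {set A2 * B1}) (S : {set A2 * B2}) : {set (A1 + A2) * (B1 + B2)} :=
  [set p | match p with
           | (inl a, inl b) => (a, b) \in R
           | (inr a, inl b) => (a, b) \in X
           | (inr a, inr b) => (a, b) \in S
           | (inl _, inr _) => false
           end].

(* [None] means that the source (target) of the edge is undefined; a graph is
   a pre-graph without dangling edges. *)
Record pregraph := Pregraph {
  vert : finType;
  edge : finType;
  src : edge -> option vert;
  tgt : edge -> option vert }.

Definition dangling (G : pregraph) (e : edge G) : bool :=
  (src e == None) || (tgt e == None).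

Definition is_graph (G : pregraph) : Prop := forall e : edge G, ~~ dangling e.

Definition gsum (G H : pregraph) : pregraph :=
  @Pregraph (vert G + vert H)%type (edge G + edge H)%type
    (fun e => match e with
              | inl e => omap inl (src e) | inr e => omap inr (src e) end)
    (fun e => match e with
              | inl e => omap inl (tgt e) | inr e => omap inr (tgt e) end).

(* First component on vertices, second component on edges. *)
Definition grel (G H : pregraph) : finType :=
  ({set vert G * vert H} * {set edge G * edge H})%type.

Definition gcomp (G H K : pregraph) (S : grel H K) (R : grel G H) : grel G K :=
  (rcomp S.1 R.1, rcomp S.2 R.2).
Definition gconv (G H : pregraph) (R : grel G H) : grel H G :=
  (rconv R.1, rconv R.2).
Definition gstar (G : pregraph) (R : grel G G) : grel G G :=
  (rstar R.1, rstar R.2).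
Definition grel0 (G H : pregraph) : grel G H := (set0, set0).
Definition gone_to_one (G H : pregraph) (R : grel G H) : Prop :=
  one_to_one R.1 /\ one_to_one R.2.

Notation "S \og R" := (gcomp S R) (at level 50, left associativity).

(* [(e, e') \in R] implies [(s(e), s(e')) \in R] and [(t(e), t(e')) \in R],
   whenever both sources (targets) are defined. *)
Definition compatible (G H : pregraph) (R : grel G H) : Prop :=
  forall e e', (e, e') \in R.2 ->
    (forall v v', src e = Some v -> src e' = Some v' -> (v, v') \in R.1) /\
    (forall v v', tgt e = Some v -> tgt e' = Some v' -> (v, v') \in R.1).

(* The raw tuples [(I, O, r, m, s, t)], with [s], [t] possibly partial. *)
Record diagram := Diagram {
  inp : pregraph;
  out : pregraph;
  rr : grel inp out;
  mm : grel out inp }.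

Definition omega (d : diagram) : grel (out d) (inp d) :=
  mm d \og gstar (rr d \og mm d).

Definition item (d : diagram) : finType :=
  ((vert (inp d) + edge (inp d)) + (vert (out d) + edge (out d)))%type.

Definition linked (d : diagram) (x y : item d) : bool :=
  match x, y with
  | inl (inr e), inl (inl v) => (src e == Some v) || (tgt e == Some v)
  | inr (inr e), inr (inl v) => (src e == Some v) || (tgt e == Some v)
  | inl (inl v), inr (inl v') => (v, v') \in (rr d).1
  | inl (inr e), inr (inr e') => (e, e') \in (rr d).2
  | _, _ => false
  end.

(* The sub-rule of [(I, O, r, s, t)] carried by [X] is the disjoint union of
   the non-empty rules carried by [Y] and [Z]. *)
Definition splits_on (d : diagram) (X Y Z : {set item d}) : Prop :=
  [/\ Y <> set0, Z <> set0, X = Y :|: Z, [disjoint Y & Z]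
    & forall y z, y \in Y -> z \in Z -> ~~ linked y z && ~~ linked z y].

Definition connected_on (d : diagram) (X : {set item d}) : Prop :=
  X <> set0 /\ ~ exists Y Z, splits_on X Y Z.

(* [k] assigns to each vertex or edge of [I] and [O] the number of its
   constituent; the fibres of [k] are the rules [r_i : I_i -> O_i]. *)
Definition is_numbering (d : diagram) (n : nat) (k : item d -> 'I_n) : Prop :=
  [/\ forall x y, linked x y -> k x = k y,
      forall i, connected_on [set x | k x == i],
      forall v v', (v', v) \in (mm d).1 ->
        (k (inl (inl v)) < k (inr (inl v')))%N
    & forall e e', (e', e) \in (mm d).2 ->
        (k (inl (inr e)) < k (inr (inr e')))%N].

Definition is_prediagram (d : diagram) : Prop :=
  [/\ gone_to_one (rr d) /\ compatible (rr d),
      gone_to_one (mm d),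
      compatible (omega d)
    & exists n (k : item d -> 'I_n), is_numbering k].

Definition is_rule_diagram (d : diagram) : Prop :=
  [/\ is_prediagram d, is_graph (inp d) & is_graph (out d)].

Definition is_irr (d : diagram) : Prop :=
  is_rule_diagram d /\ mm d = grel0 _ _.

Definition is_irr_pre (d : diagram) : Prop :=
  is_prediagram d /\ mm d = grel0 _ _.

Definition gempty : pregraph :=
  @Pregraph void void (fun _ => None) (fun _ => None).

Definition dempty : diagram := @Diagram gempty gempty (grel0 _ _) (grel0 _ _).

Definition dcomp (a b : diagram) (m : grel (out b) (inp a)) : diagram :=
  @Diagram (gsum (inp a) (inp b)) (gsum (out a) (out b))
    (rblock (rr a).1 set0 (rr b).1, rblock (rr a).2 set0 (rr b).2)
    (rblock (mm a).1 m.1 (mm b).1, rblock (mm a).2 m.2 (mm b).2).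

(* The element [v] of the subtype [P] such that [(w, v) \in R], if [w] is
   defined and such a [v] exists. *)
Definition endpoint (V : finType) (P : pred V) (R : {set V * V})
    (w : option V) : option {v : V | P v} :=
  obind (fun w => [pick v : {v : V | P v} | (w, val v) \in R]) w.

Definition grestr (G : pregraph) (PV : pred (vert G)) (PE : pred (edge G))
    (R : {set vert G * vert G}) : pregraph :=
  @Pregraph {v : vert G | PV v} {e : edge G | PE e}
    (fun e => endpoint PV R (src (val e)))
    (fun e => endpoint PV R (tgt (val e))).

Section Boundary.
Variable d : diagram.
Let r := rr d.
Let m := mm d.

Definition bdry_inp : pregraph :=
  @grestr (inp d) (fun v => v \notin rim m.1) (fun e => e \notin rim m.2)
    (gstar (gconv r \og gconv m)).1.

Definition bdry_out : pregraph :=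
  @grestr (out d) (fun v => v \notin rdom m.1) (fun e => e \notin rdom m.2)
    (gstar (r \og m)).1.

Definition bdry : diagram :=
  @Diagram bdry_inp bdry_out
    (pull val val (r \og gstar (m \og r)).1,
     pull val val (r \og gstar (m \og r)).2)
    (grel0 _ _).

End Boundary.

Definition del_dangling (G : pregraph) : pregraph :=
  @Pregraph (vert G) {e : edge G | ~~ dangling e}
    (fun e => src (val e)) (fun e => tgt (val e)).

Definition spoA (d : diagram) : diagram :=
  @Diagram (inp d) (del_dangling (out d))
    ((rr d).1, pull id val (rr d).2) ((mm d).1, pull val id (mm d).2).

Definition spoB (d : diagram) : diagram :=
  @Diagram (del_dangling (inp d)) (out d)
    ((rr d).1, pull val id (rr d).2) ((mm d).1, pull id val (mm d).2).

Definition graph_iso (G H : pregraph)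
    (f : (vert G -> vert H) * (edge G -> edge H)) : Prop :=
  [/\ bijective f.1, bijective f.2,
      forall e, src (f.2 e) = omap f.1 (src e)
    & forall e, tgt (f.2 e) = omap f.1 (tgt e)].

Definition rel_iso (G H G' H' : pregraph)
    (f : (vert G -> vert G') * (edge G -> edge G'))
    (g : (vert H -> vert H') * (edge H -> edge H'))
    (R : grel G H) (R' : grel G' H') : Prop :=
  (forall v w, ((f.1 v, g.1 w) \in R'.1) = ((v, w) \in R.1)) /\
  (forall e e', ((f.2 e, g.2 e') \in R'.2) = ((e, e') \in R.2)).

Definition diagram_iso (d d' : diagram) : Prop :=
  exists iI iO, [/\ @graph_iso (inp d) (inp d') iI,
                    @graph_iso (out d) (out d') iO,
                    rel_iso iI iO (rr d) (rr d')
                  & rel_iso iO iI (mm d) (mm d')].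

Lemma graph_iso_id G : @graph_iso G G (id, id).
Proof.
split; try by exists id.
  by move=> e /=; case: (src e).
by move=> e /=; case: (tgt e).
Qed.

Lemma graph_iso_comp G H K f g : @graph_iso G H f -> @graph_iso H K g ->
  @graph_iso G K (g.1 \o f.1, g.2 \o f.2).
Proof.
move=> [b1 b2 s t] [c1 c2 s' t']; split=> /=; try exact: bij_comp.
  by move=> e; rewrite s' s; case: (src e).
by move=> e; rewrite t' t; case: (tgt e).
Qed.

Lemma graph_iso_inv G H f : @graph_iso G H f ->
  exists g, [/\ @graph_iso H G g, cancel f.1 g.1, cancel g.1 f.1,
    cancel f.2 g.2 & cancel g.2 f.2].
Proof.
move=> [[g1 K1 L1] [g2 K2 L2] s t]; exists (g1, g2); split=> //.
split=> /=; [by exists f.1 | by exists f.2 | |] => e.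
  by rewrite -[e in RHS]L2 s; case: (src _) => //= v; rewrite K1.
by rewrite -[e in RHS]L2 t; case: (tgt _) => //= v; rewrite K1.
Qed.

Lemma diagram_iso_refl d : diagram_iso d d.
Proof. by exists (id, id), (id, id); split=> //; apply: graph_iso_id. Qed.

Lemma diagram_iso_sym d d' : diagram_iso d d' -> diagram_iso d' d.
Proof.
move=> [f [g [/graph_iso_inv[f' [Hf f1 f2 f3 f4]]]]].
move=> /graph_iso_inv[g' [Hg g1 g2 g3 g4]] [r1 r2] [m1 m2].
exists f', g'; split=> //; split=> x y.
- by rewrite -r1 f2 g2.
- by rewrite -r2 f4 g4.
- by rewrite -m1 f2 g2.
by rewrite -m2 f4 g4.
Qed.

Lemma diagram_iso_trans d d' d'' :
  diagram_iso d d' -> diagram_iso d' d'' -> diagram_iso d d''.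
Proof.
move=> [f [g [Hf Hg [r1 r2] [m1 m2]]]] [f' [g' [Hf' Hg' [r1' r2'] [m1' m2']]]].
exists (f'.1 \o f.1, f'.2 \o f.2), (g'.1 \o g.1, g'.2 \o g.2).
split; try exact: graph_iso_comp.
  by split=> x y /=; rewrite ?r1' ?r2' ?r1 ?r2.
by split=> x y /=; rewrite ?m1' ?m2' ?m1 ?m2.
Qed.

(* Every diagram is isomorphic to one carried by the sets {0, ..., n-1}; such
   diagrams form a (small) choice type, of which we take the quotient. *)
Definition gskel : choiceType :=
  {n : nat * nat &
    ({ffun 'I_n.2 -> option 'I_n.1} * {ffun 'I_n.2 -> option 'I_n.1})%type}.

Definition of_gskel (G : gskel) : pregraph :=
  @Pregraph 'I_(tag G).1 'I_(tag G).2 (tagged G).1 (tagged G).2.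

Definition skel : choiceType :=
  {G : gskel * gskel & (grel (of_gskel G.1) (of_gskel G.2) *
                        grel (of_gskel G.2) (of_gskel G.1))%type}.

Definition of_skel (x : skel) : diagram :=
  @Diagram _ _ (tagged x).1 (tagged x).2.

Definition to_gskel (G : pregraph) : gskel :=
  Tagged (fun n : nat * nat => ({ffun 'I_n.2 -> option 'I_n.1} *
                                {ffun 'I_n.2 -> option 'I_n.1})%type)
    (i := (#|vert G|, #|edge G|))
    ([ffun e => omap enum_rank (src (enum_val e))],
     [ffun e => omap enum_rank (tgt (enum_val e))]).

Definition to_grel (G H : pregraph) (R : grel G H) :
    grel (of_gskel (to_gskel G)) (of_gskel (to_gskel H)) :=
  (pull enum_val enum_val R.1, pull enum_val enum_val R.2).

Definition to_skel (d : diagram) : skel :=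
  Tagged (fun G : gskel * gskel => (grel (of_gskel G.1) (of_gskel G.2) *
                                    grel (of_gskel G.2) (of_gskel G.1))%type)
    (i := (to_gskel (inp d), to_gskel (out d)))
    (to_grel (rr d), to_grel (mm d)).

Definition skel_iso (x y : skel) : bool := `[< diagram_iso (of_skel x) (of_skel y) >].

Lemma skel_iso_equiv : equiv_class_of skel_iso.
Proof.
split=> [x|x y|y x z].
- by apply/asboolP/diagram_iso_refl.
- by apply/asboolP/asboolP; apply: diagram_iso_sym.
by move=> /asboolP h /asboolP h'; apply/asboolP/(diagram_iso_trans h h').
Qed.

Canonical skel_iso_equivRel := EquivRelPack skel_iso_equiv.

Definition diagram_class : choiceType := {eq_quot skel_iso}.

Definition class (d : diagram) : diagram_class := \pi_diagram_class (to_skel d).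

Lemma to_skelK d : diagram_iso d (of_skel (to_skel d)).
Proof.
have gi G : @graph_iso G (of_gskel (to_gskel G)) (enum_rank, enum_rank).
  by split=> [||e|e] /=; try exact: enum_rank_bij; rewrite ffunE enum_rankK.
have ri G H R : @rel_iso G H (of_gskel (to_gskel G)) (of_gskel (to_gskel H))
    (enum_rank, enum_rank) (enum_rank, enum_rank) R (to_grel R).
  by split=> x y /=; rewrite inE /= !enum_rankK.
by exists (enum_rank, enum_rank), (enum_rank, enum_rank).
Qed.

Lemma classP d d' : class d = class d' <-> diagram_iso d d'.
Proof.
split=> [/eqmodP/asboolP h|h].
  apply: diagram_iso_trans (to_skelK d) _; apply: diagram_iso_trans h _.
  exact/diagram_iso_sym/to_skelK.
apply/eqmodP/asboolP; apply: diagram_iso_trans (to_skelK d').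
by apply: diagram_iso_trans h; apply/diagram_iso_sym/to_skelK.
Qed.

(* The isomorphism classes of diagrams with property [P]. *)
Definition classes (P : diagram -> Prop) : choiceType :=
  {x : diagram_class | `[< exists2 d, P d & class d = x >]}.

Section Classes.
Variable P : diagram -> Prop.

Definition rep (x : classes P) : diagram := s2val (cid2 (asboolW (valP x))).

Lemma repP (x : classes P) : P (rep x).
Proof. exact: s2valP (cid2 (asboolW (valP x))). Qed.

Lemma class_rep (x : classes P) : class (rep x) = val x.
Proof. exact: s2valP' (cid2 (asboolW (valP x))). Qed.

Lemma class_subproof d : P d -> `[< exists2 d', P d' & class d' = class d >].
Proof. by move=> Pd; apply/asboolP; exists d. Qed.

Definition mkclass (d : diagram) (Pd : P d) : classes P :=
  Sub (class d) (class_subproof Pd).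

End Classes.

Lemma grel0_compatible G H : compatible (grel0 G H).
Proof. by move=> e e'; rewrite inE. Qed.

Lemma grel0_one_to_one G H : gone_to_one (grel0 G H).
Proof. by split=> p q; rewrite inE. Qed.

Lemma omega0 d : mm d = grel0 _ _ -> omega d = grel0 _ _.
Proof.
rewrite /omega /gcomp => ->; congr pair; apply/setP=> p; rewrite !inE /=;
by apply/existsP=> -[b]; rewrite in_set0 andbF.
Qed.

Lemma has_numbering d : mm d = grel0 _ _ ->
  exists n (k : item d -> 'I_n), is_numbering k.
Proof.
move=> m0; pose e : rel (item d) := [rel x y | linked x y || linked y x].
have es : connect_sym e by apply: sym_connect_sym => x y; rewrite /e /= orbC.
pose S : finType := {x : item d | x \in fingraph.roots e}.
pose k0 x : S := Sub (fingraph.root e x) (roots_root es x).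
exists #|S|, (enum_rank \o k0).
have kE x y : ((enum_rank \o k0) x == (enum_rank \o k0) y) = connect e x y.
  by rewrite (inj_eq enum_rank_inj) -val_eqE /= (root_connect es).
split=> [x y lxy|i|v v'|f f'].
- by apply/eqP; rewrite kE connect1 // /e /= lxy.
- split.
    apply/eqP/set0Pn; exists (val (enum_val i)); rewrite inE /=.
    rewrite -[X in _ == X]enum_valK (inj_eq enum_rank_inj) -val_eqE /=.
    exact: (valP (enum_val i)).
  move=> [Y [Z [/eqP/set0Pn[y yY] /eqP/set0Pn[z zZ] XE YZ sep]]].
  have kX x : x \in Y :|: Z -> (enum_rank \o k0) x = i.
    by rewrite -XE inE => /eqP.
  have clY : closed e (mem Y).
    apply: (intro_closed es) => x w exw xY.
    have : w \in Y :|: Z.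
      rewrite -XE inE -(kX x) ?inE ?xY // eq_sym kE; exact: connect1.
    rewrite inE => /orP[//|wZ].
    by have := sep _ _ xY wZ; move: exw => /= /orP[] ->; rewrite ?andbF.
  have cyz : connect e y z by rewrite -kE !kX // inE ?yY ?zZ ?orbT.
  have := closed_connect clY cyz; rewrite yY => /esym zY.
  by move: YZ => /pred0P/(_ z) /=; rewrite zZ andbT => zY'; rewrite zY' in zY.
- by rewrite m0 inE.
by rewrite m0 inE.
Qed.

Lemma irr_preI d : gone_to_one (rr d) -> compatible (rr d) ->
  mm d = grel0 _ _ -> is_irr_pre d.
Proof.
move=> r1 rc m0; split=> //; split=> //.
- by rewrite m0; apply: grel0_one_to_one.
- by rewrite (omega0 m0); apply: grel0_compatible.
exact: has_numbering.
Qed.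

Lemma is_irr_dempty : is_irr dempty.
Proof.
have [||//|p _] := @irr_preI dempty.
- exact: grel0_one_to_one.
- exact: grel0_compatible.
by split=> //; split=> // -[].
Qed.

Lemma is_irr_rule d : is_irr d -> is_rule_diagram d.
Proof. by case. Qed.

Lemma is_irr_prediagram d :
  is_irr_pre d -> is_graph (inp d) -> is_graph (out d) -> is_irr d.
Proof. by case=> p m0 gi go; split. Qed.

Lemma one_to_one_pull (A B A' B' : finType) (f : A' -> A) (g : B' -> B)
    (R : {set A * B}) :
  injective f -> injective g -> one_to_one R -> one_to_one (pull f g R).
Proof.
move=> fI gI oR [a b] [a' b']; rewrite !inE /= => h h' ne.
have [|/= n1 n2] := oR _ _ h h'.
  by case=> /fI e /gI e'; apply: ne; rewrite e e'.
by split=> e; [apply: n1|apply: n2]; rewrite e.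
Qed.

Lemma is_irr_pre_spoA d : is_irr_pre d -> is_irr_pre (spoA d).
Proof.
move=> [[[[r1 r2] rc] _ _ _] m0]; apply: irr_preI => /=.
- by split=> //; apply: one_to_one_pull => //; apply: val_inj.
- by move=> e e'; rewrite inE => /rc.
by rewrite m0; congr pair; apply/setP=> p; rewrite !inE.
Qed.

Lemma is_irr_pre_spoB d : is_irr_pre d -> is_irr_pre (spoB d).
Proof.
move=> [[[[r1 r2] rc] _ _ _] m0]; apply: irr_preI => /=.
- by split=> //; apply: one_to_one_pull => //; apply: val_inj.
- by move=> e e'; rewrite inE => /rc.
by rewrite m0; congr pair; apply/setP=> p; rewrite !inE.
Qed.

Lemma rcompP (A B C : finType) (S : {set B * C}) (R : {set A * B}) a c :
  reflect (exists2 b, (a, b) \in R & (b, c) \in S) ((a, c) \in rcomp S R).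
Proof.
rewrite inE /=; apply: (iffP existsP) => [[b /andP[]]|[b h h']]; exists b => //.
by rewrite h h'.
Qed.

Lemma one_to_oneP (A B : finType) (R : {set A * B}) : one_to_one R <->
  (forall a b b', (a, b) \in R -> (a, b') \in R -> b = b') /\
  (forall a a' b, (a, b) \in R -> (a', b) \in R -> a = a').
Proof.
split=> [oR|[f g] [a b] [a' b'] /= h h' ne].
  by split=> x y z h h'; apply: contrapT => ne; have [|/=] := oR _ _ h h';
    do ?[by case|by case=> ? ?; apply: ne].
split=> E; subst; apply: ne; congr pair; first exact: f h h'.
exact: g h h'.
Qed.

Lemma terminal_uniq (V : finType) (e : rel V) x y z :
  (forall u v w, e u v -> e u w -> v = w) ->
  connect e x y -> connect e x z ->
  (forall w, ~~ e y w) -> (forall w, ~~ e z w) -> y = z.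
Proof.
move=> det /connectP[p ep ->] + ty tz; elim: p x ep ty => [|a p IHp] x /=.
  move=> _ ty /connectP[[|b q] //= /andP[exb _] _].
  by have := ty b; rewrite exb.
move=> /andP[exa ep] ty /connectP[[|b q] /= h zE].
  by have := tz a; rewrite zE exa.
move: h => /andP[exb eq]; rewrite (det _ _ _ exb exa) in eq zE.
by apply: IHp => //; apply/connectP; exists q.
Qed.

Section Trajectories.
Variables (V W : finType) (r : {set V * W}) (m : {set W * V}).

Lemma rstar_conv u v :
  (u, v) \in rstar (rcomp (rconv r) (rconv m)) -> (v, u) \in rstar (rcomp m r).
Proof.
rewrite !inE /= => h.
suff: connect [rel x y | (y, x) \in rcomp m r] u v by rewrite connect_rev.
apply: connect_sub h => x y /= /rcompP[b]; rewrite !inE /= => ? ?.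
by apply: connect1; apply/rcompP; exists b.
Qed.

Lemma rstar_shift u c c' : (u, c) \in r -> (c, c') \in rstar (rcomp r m) ->
  (u, c') \in rcomp r (rstar (rcomp m r)).
Proof.
move=> uc; rewrite inE /= => /connectP[p cp ->].
elim: p u c uc cp => [|c1 p IHp] u c uc /=.
  by move=> _; apply/rcompP; exists u => //; rewrite inE.
move=> /andP[/rcompP[v cv vc1] cp].
have /rcompP[x vx xl] := IHp _ _ vc1 cp; apply/rcompP; exists x => //.
rewrite !inE /= in vx *; apply: connect_trans (connect1 _) vx.
by apply/rcompP; exists c.
Qed.

Lemma rstar_trans u v w : (u, v) \in rstar (rcomp m r) ->
  (v, w) \in rstar (rcomp m r) -> (u, w) \in rstar (rcomp m r).
Proof. by rewrite !inE; apply: connect_trans. Qed.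

Hypothesis r11 : one_to_one r.
Hypothesis m11 : one_to_one m.

Lemma traj_out_uniq a b b' : b \notin rdom m -> b' \notin rdom m ->
  (a, b) \in rcomp r (rstar (rcomp m r)) ->
  (a, b') \in rcomp r (rstar (rcomp m r)) -> b = b'.
Proof.
have [rf ri] := (one_to_oneP r).1 r11; have [mf mi] := (one_to_oneP m).1 m11.
move=> bm bm' /rcompP[x ax xb] /rcompP[x' ax' xb'].
have term y c : (y, c) \in r -> c \notin rdom m ->
    forall w, (y, w) \notin rcomp m r.
  move=> yc cm w; apply/rcompP => -[c' yc' cw]; move/negP: cm; apply.
  by rewrite (rf _ _ _ yc yc'); apply/imsetP; exists (c', w).
rewrite !inE /= in ax ax'; have xx' : x = x'.
  apply: terminal_uniq ax ax' _ _; [|exact: term xb bm|exact: term xb' bm'].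
  move=> u v w /rcompP[c uc cv] /rcompP[c' uc' cw].
  by rewrite (rf _ _ _ uc uc') in cv; apply: mf cv cw.
by rewrite xx' in xb; apply: rf xb xb'.
Qed.

Lemma traj_in_uniq a a' b : a \notin rim m -> a' \notin rim m ->
  (a, b) \in rcomp r (rstar (rcomp m r)) ->
  (a', b) \in rcomp r (rstar (rcomp m r)) -> a = a'.
Proof.
have [rf ri] := (one_to_oneP r).1 r11; have [mf mi] := (one_to_oneP m).1 m11.
move=> am am' /rcompP[x ax xb] /rcompP[x' ax' xb'].
rewrite -(ri _ _ _ xb xb') !inE /= in ax' ax.
pose e := [rel x y | (y, x) \in rcomp m r].
have init y : y \notin rim m -> forall w, ~~ e y w.
  move=> ym w; apply/rcompP => -[c wc cy]; move/negP: ym; apply.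
  by apply/imsetP; exists (c, y).
apply: (@terminal_uniq _ e x _ _ _ _ _ (init _ am) (init _ am')).
- move=> u v w /rcompP[c vc cu] /rcompP[c' wc' cu'].
  by rewrite (mi _ _ _ cu cu') in vc; apply: ri vc wc'.
- by rewrite /e connect_rev.
by rewrite /e connect_rev.
Qed.

Lemma one_to_one_bdry (PV : pred V) (PW : pred W) :
  (forall v, PV v -> v \notin rim m) -> (forall w, PW w -> w \notin rdom m) ->
  one_to_one (pull (fun v : {v : V | PV v} => val v)
                   (fun w : {w : W | PW w} => val w)
                   (rcomp r (rstar (rcomp m r)))).
Proof.
move=> hV hW; apply/one_to_oneP; split=> x y z.
  rewrite in_set => h; rewrite in_set => h'; apply/val_inj.
  by apply: traj_out_uniq h h'; apply/hW/valP.
rewrite in_set => h; rewrite in_set => h'; apply/val_inj.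
by apply: traj_in_uniq h h'; apply/hV/valP.
Qed.

End Trajectories.

Section TrajectoryEnds.
Variables (EI VI EO VO : finType) (rV : {set VI * VO}) (mV : {set VO * VI}).
Variables (rE : {set EI * EO}) (mE : {set EO * EI}).
Variables (fI : EI -> option VI) (fO : EO -> option VO).
Hypothesis fI_total : forall e, fI e <> None.
Hypothesis fO_total : forall e, fO e <> None.
Hypothesis rc : forall e e', (e, e') \in rE -> forall v v',
  fI e = Some v -> fO e' = Some v' -> (v, v') \in rV.
Hypothesis mc : forall e e', (e, e') \in rcomp mE (rstar (rcomp rE mE)) ->
  forall v v', fO e = Some v -> fI e' = Some v' ->
  (v, v') \in rcomp mV (rstar (rcomp rV mV)).

Lemma traj_ends e e' u u' : (e, e') \in rcomp rE (rstar (rcomp mE rE)) ->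
  fI e = Some u -> fO e' = Some u' ->
  (u, u') \in rcomp rV (rstar (rcomp mV rV)).
Proof.
move=> /rcompP[x + xe'] fe fe'; rewrite inE /= => /connectP[p ep xE].
have [w fx uw] : exists2 w, fI x = Some w & (u, w) \in rstar (rcomp mV rV).
  elim: p e u fe ep xE => [|y p IHp] e u fe /=.
    by move=> _ ->; exists u => //; rewrite inE.
  move=> /andP[/rcompP[b eb bY] yp] xE.
  case fb: (fO b) (@fO_total b) => [c|//] _; case fy: (fI y) (@fI_total y) => [v|//] _.
  have uc := rc eb fe fb.
  have /rcompP[c' cc' cv] : (c, v) \in rcomp mV (rstar (rcomp rV mV)).
    by apply: mc fb fy; apply/rcompP; exists b => //; rewrite inE.
  have [w fx vw] := IHp _ _ fy yp xE; exists w => //.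
  have /rcompP[z uz zc'] := rstar_shift uc cc'.
  apply: rstar_trans uz (rstar_trans _ vw).
  by rewrite inE; apply: connect1; apply/rcompP; exists c'.
by apply/rcompP; exists w => //; apply: rc fx fe'.
Qed.

Lemma bdry_ends (PI : pred VI) (PO : pred VO) e e' v v' :
  (e, e') \in rcomp rE (rstar (rcomp mE rE)) ->
  endpoint PI (rstar (rcomp (rconv rV) (rconv mV))) (fI e) = Some v ->
  endpoint PO (rstar (rcomp rV mV)) (fO e') = Some v' ->
  (val v, val v') \in rcomp rV (rstar (rcomp mV rV)).
Proof.
move=> ee'; case fe: (fI e) => [u|//] /=; case: pickP => // z /rstar_conv zu [<-].
case fe': (fO e') => [u'|//] /=; case: pickP => // z' uz' [<-].
have /rcompP[w uw wu'] := traj_ends ee' fe fe'.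
have /rcompP[y wy yz'] := rstar_shift wu' uz'.
by apply/rcompP; exists y => //; apply: rstar_trans zu (rstar_trans uw wy).
Qed.

End TrajectoryEnds.

Lemma is_irr_pre_bdry d : is_rule_diagram d -> is_irr_pre (bdry d).
Proof.
move=> [[[[r1 r2] rc] [m1 m2] mc _] gI gO]; apply: irr_preI => //.
  by split; apply: one_to_one_bdry.
have nN (G : pregraph) : is_graph G ->
    (forall e : edge G, src e <> None) /\ (forall e : edge G, tgt e <> None).
  by move=> gG; split=> e h; have := gG e; rewrite /dangling h ?orbT.
have [sI tI] := nN _ gI; have [sO tO] := nN _ gO.
move=> e e'; rewrite inE => ee'; split=> v v' hv hv'; rewrite inE.
  apply: (bdry_ends sI sO _ _ ee' hv hv') => f f' ff'.
    by case: (rc _ _ ff').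
  by case: (mc _ _ ff').
apply: (bdry_ends tI tO _ _ ee' hv hv') => f f' ff'.
  by case: (rc _ _ ff').
by case: (mc _ _ ff').
Qed.

Inductive semantics := DPO | SPO_A | SPO_B | SPO_AB.

Section RuleAlgebra.
Variable K : fieldType.

(* [{malg K[B]}] is only used as the free [K]-vector space on [B]. *)
Definition ruleD : lmodType K := {malg K[classes is_rule_diagram]}.
Definition irrD : lmodType K := {malg K[classes is_irr]}.
Definition preD : lmodType K := {malg K[classes is_irr_pre]}.

Definition lin_ext (B : choiceType) (V : lmodType K) (f : B -> V)
    (x : {malg K[B]}) : V :=
  \sum_(b <- msupp x) x@_b *: f b.

Definition psi : irrD -> ruleD :=
  lin_ext (fun x => << mkclass (is_irr_rule (repP x)) >> : ruleD).

(* The sum runs over the [m] for which [dcomp m] is a rule diagram; this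
   includes the requirement that the [m] of [dcomp m] is one-to-one. *)
Definition comp_basis (a b : classes is_rule_diagram) : ruleD :=
  \sum_(m : grel (out (rep b)) (inp (rep a)))
    match pselect (is_rule_diagram (dcomp m)) with
    | left h => << mkclass h >>
    | right _ => 0
    end.

Definition mulD (x y : ruleD) : ruleD :=
  lin_ext (fun a => lin_ext (comp_basis a) y) x.

Definition bdryD : ruleD -> preD :=
  lin_ext (fun x => << mkclass (is_irr_pre_bdry (repP x)) >> : preD).

Definition fspoA : preD -> preD :=
  lin_ext (fun x => << mkclass (is_irr_pre_spoA (repP x)) >> : preD).

Definition fspoB : preD -> preD :=
  lin_ext (fun x => << mkclass (is_irr_pre_spoB (repP x)) >> : preD).

Definition projP : preD -> irrD :=
  lin_ext (fun x : classes is_irr_pre =>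
    match pselect (is_graph (inp (rep x)) /\ is_graph (out (rep x))) with
    | left h => << mkclass (is_irr_prediagram (repP x) h.1 h.2) >> : irrD
    | right _ => 0
    end).

Definition reduce (T : semantics) : preD -> irrD :=
  match T with
  | DPO => projP
  | SPO_A => projP \o fspoA
  | SPO_B => projP \o fspoB
  | SPO_AB => projP \o fspoA \o fspoB
  end.

Definition phi (T : semantics) : ruleD -> irrD := reduce T \o bdryD.

Definition mulR (T : semantics) (x y : irrD) : irrD :=
  phi T (mulD (psi x) (psi y)).

Definition unit_irr : irrD := << mkclass is_irr_dempty >>.

Definition assoc_unital_algebra (V : lmodType K) (mul : V -> V -> V) (one : V)
    : Prop :=
  [/\ forall x, linear (mul x), forall y, linear (mul^~ y),
      associative mul, left_id one mul & right_id one mul].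

End RuleAlgebra.

(* Main.v *)
From mathcomp Require Import all_boot all_algebra.
From mathcomp Require Import finmap boolp monalg.
Require Import Defs.

(** A matching [m] of a composite [A m B] only sees the boundaries of [A] and [B]:
    it relates unmatched outputs of [B] to unmatched inputs of [A], and an edge can
    be matched only if its ends can be pushed along trajectories to unmatched
    vertices, i.e. if it is not dangling in the boundary. So matchings of [(A, B)]
    correspond to matchings of the boundaries with all dangling edges deleted.
    Trajectories of [A m B] are concatenations of a trajectory of [B], a step of [m]
    and a trajectory of [A], so corresponding composites have the same reduced
    boundary; an edge dangling in [A] or [B] is never matched and stays dangling in
    [A m B], so it annihilates both sides or is deleted on both sides. This makes the
    reduction a homomorphism; since it is a retraction of the inclusion of
    irreducible diagrams, associativity and the unit are inherited from the
    composition of rule diagrams, where associativity amounts to summing over the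
    matchings between three diagrams. *)

Set Implicit Arguments.
Unset Strict Implicit.
Unset Printing Implicit Defensive.

Import GRing.Theory.
Local Open Scope ring_scope.

(** * Relations and trajectories *)

Section RelationAlgebra.

(** The four semantics are treated at once. The full reduction, with dangling edges deleted on both
    sides, does not depend on [T]. If [phi T] does not vanish on a basis diagram, its value there is
    the full reduction: a side on which [T] deletes nothing then has no dangling edge, so deleting
    would not change it. Hence [T] enters only through the predicate [clean], and two things are
    compared separately for corresponding composites: their full reductions and their dangling
    conditions. The obstacle is that boundaries are built from subtypes and from chosen
    representatives of classes, so hardly any two of them are equal. They are therefore not
    manipulated directly: [reduct] characterizes a boundary by embeddings into the original diagram.
    This makes it invariant under isomorphism on both sides, unique up to isomorphism, and
    computable in two stages, first inside the factors of a composite and then across the crossing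
    matches. *)

Lemma rcompA (A B C D : finType) (U : {set C * D}) (S : {set B * C})
    (R : {set A * B}) : rcomp U (rcomp S R) = rcomp (rcomp U S) R.
Proof.
apply/setP=> -[a d]; apply/rcompP/rcompP => [[c /rcompP[b ab bc] cd]|].
  by exists b => //; apply/rcompP; exists c.
by move=> [b ab /rcompP[c bc cd]]; exists c => //; apply/rcompP; exists b.
Qed.

Lemma rcomp0r (A B C : finType) (S : {set B * C}) :
  rcomp S (set0 : {set A * B}) = set0.
Proof. by apply/setP=> -[a c]; rewrite in_set0; apply/rcompP => -[b]; rewrite inE. Qed.

Lemma rcomp0l (A B C : finType) (R : {set A * B}) :
  rcomp (set0 : {set B * C}) R = set0.
Proof. by apply/setP=> -[a c]; rewrite in_set0; apply/rcompP => -[b] _; rewrite inE. Qed.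

Lemma rcompUl (A B C : finType) (S S' : {set B * C}) (R : {set A * B}) :
  rcomp (S :|: S') R = rcomp S R :|: rcomp S' R.
Proof.
apply/setP=> -[a c]; rewrite in_setU; apply/rcompP/orP.
  by move=> [b ab]; rewrite in_setU => /orP[] h; [left|right]; apply/rcompP; exists b.
by move=> [] /rcompP[b ab bc]; exists b => //; rewrite inE bc ?orbT.
Qed.

Definition rid (A : finType) : {set A * A} := [set p | p.1 == p.2].

Lemma in_rid (A : finType) (x y : A) : ((x, y) \in rid A) = (x == y).
Proof. by rewrite inE. Qed.

Lemma rcomp1l (A B : finType) (R : {set A * B}) : rcomp (rid B) R = R.
Proof.
apply/setP=> -[a b]; apply/rcompP/idP => [[c ac]|ab]; first by rewrite inE => /= /eqP <-.
by exists b; rewrite ?inE.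
Qed.

Lemma rcomp1r (A B : finType) (R : {set A * B}) : rcomp R (rid A) = R.
Proof.
apply/setP=> -[a b]; apply/rcompP/idP => [[c]|ab]; first by rewrite inE => /= /eqP <-.
by exists a; rewrite ?inE.
Qed.

Lemma in_rconv (A B : finType) (R : {set A * B}) x y :
  ((x, y) \in rconv R) = ((y, x) \in R).
Proof. by rewrite inE. Qed.

Lemma in_pull (A B A' B' : finType) (f : A' -> A) (g : B' -> B)
  (R : {set A * B}) x y : ((x, y) \in pull f g R) = ((f x, g y) \in R).
Proof. by rewrite inE. Qed.

Lemma rdomP (A B : finType) (R : {set A * B}) x :
  reflect (exists y, (x, y) \in R) (x \in rdom R).
Proof.
apply: (iffP imsetP) => [[[a b] h ->]|[y h]]; first by exists b.
by exists (x, y).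
Qed.

Lemma rimP (A B : finType) (R : {set A * B}) y :
  reflect (exists x, (x, y) \in R) (y \in rim R).
Proof.
apply: (iffP imsetP) => [[[a b] h ->]|[x h]]; first by exists a.
by exists (x, y).
Qed.

Section Star.
Variables (A : finType).
Implicit Types R : {set A * A}.

Lemma rstar_refl R x : (x, x) \in rstar R.
Proof. by rewrite inE connect0. Qed.

Lemma rstar_cons R x y z : (x, y) \in R -> (y, z) \in rstar R -> (x, z) \in rstar R.
Proof. by move=> h; rewrite !in_set; apply/connect_trans/connect1. Qed.

Lemma rstar_ind R (P : A -> A -> Prop) : (forall x, P x x) ->
  (forall x y z, (x, y) \in R -> (y, z) \in rstar R -> P y z -> P x z) ->
  forall x y, (x, y) \in rstar R -> P x y.
Proof.
move=> P0 PS x y; rewrite inE => /connectP[p /= xp ->].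
elim: p x xp => [|z p IHp] x //= /andP[xz zp].
by apply: (PS _ z) => //; [rewrite inE; apply/connectP; exists p|apply: IHp].
Qed.

Lemma rstar_cat R x y z :
  (x, y) \in rstar R -> (y, z) \in rstar R -> (x, z) \in rstar R.
Proof. by rewrite !inE; apply: connect_trans. Qed.

Lemma rstar1 R x y : (x, y) \in R -> (x, y) \in rstar R.
Proof. by move=> h; apply: rstar_cons h (rstar_refl _ _). Qed.

Lemma rstar0 : rstar (set0 : {set A * A}) = rid A.
Proof.
apply/setP=> -[x y]; rewrite in_rid; apply/idP/eqP => [|->]; last exact: rstar_refl.
by elim/rstar_ind: x y / => // x y z; rewrite inE.
Qed.

Lemma rstarE R : rstar R = rid A :|: rcomp (rstar R) R.
Proof.
apply/setP=> -[x y]; rewrite in_setU in_rid; apply/idP/orP => [|[/eqP->|]].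
- elim/rstar_ind: x y / => [x|x y z xy yz _]; first by left.
  by right; apply/rcompP; exists y.
- exact: rstar_refl.
by case/rcompP=> z; apply: rstar_cons.
Qed.

Lemma rconv_rstar R : rstar (rconv R) = rconv (rstar R).
Proof.
have sub (S : {set A * A}) : forall x y, (x, y) \in rstar (rconv S) -> (y, x) \in rstar S.
  apply: rstar_ind => [x|x y z]; first exact: rstar_refl.
  by rewrite in_rconv => yx _ zy; apply: rstar_cat zy (rstar1 yx).
apply/setP=> -[x y]; rewrite in_rconv; apply/idP/idP; first exact: sub.
move=> h; apply: (sub _ y x).
by have -> : rconv (rconv R) = R by apply/setP=> -[a b]; rewrite !in_rconv.
Qed.

End Star.

Lemma rconv_rcomp (A B C : finType) (S : {set B * C}) (R : {set A * B}) :
  rcomp (rconv R) (rconv S) = rconv (rcomp S R).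
Proof.
apply/setP=> -[c a]; rewrite in_rconv.
by apply/rcompP/rcompP => -[b h h']; exists b => //;
  do [rewrite in_rconv in h'|rewrite in_rconv]; rewrite ?in_rconv // in h *.
Qed.

(** The sliding rule of Kleene algebra: an alternating path that begins and ends with [r] can be
    bracketed from either end. *)
Lemma rstar_slide (A B : finType) (r : {set A * B}) (m : {set B * A}) :
  rcomp (rstar (rcomp r m)) r = rcomp r (rstar (rcomp m r)).
Proof.
apply/setP=> -[a b]; apply/idP/idP => [/rcompP[c]|/rcompP[c ac]].
  exact: rstar_shift.
elim/rstar_ind: a c / ac => [a ab|a c d + _ + db].
  by apply/rcompP; exists b => //; apply: rstar_refl.
move=> /rcompP[e ae ec] /(_ db)/rcompP[f cf fb]; apply/rcompP; exists e => //.
by apply: rstar_cons fb; apply/rcompP; exists c.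
Qed.

Section InBlock.
Variables (A1 A2 B1 B2 : finType).
Variables (R : {set A1 * B1}) (X : {set A2 * B1}) (S : {set A2 * B2}).

Lemma rblock_ll a b : ((inl a, inl b) \in rblock R X S) = ((a, b) \in R).
Proof. by rewrite inE. Qed.
Lemma rblock_rl a b : ((inr a, inl b) \in rblock R X S) = ((a, b) \in X).
Proof. by rewrite inE. Qed.
Lemma rblock_rr a b : ((inr a, inr b) \in rblock R X S) = ((a, b) \in S).
Proof. by rewrite inE. Qed.
Lemma rblock_lr a b : ((inl a, inr b) \in rblock R X S) = false.
Proof. by rewrite inE. Qed.

Definition in_rblock := (rblock_ll, rblock_rl, rblock_rr, rblock_lr).
End InBlock.

Lemma rcomp_rblock (A1 A2 B1 B2 C1 C2 : finType)
    (R : {set A1 * B1}) (X : {set A2 * B1}) (S : {set A2 * B2})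
    (R' : {set B1 * C1}) (X' : {set B2 * C1}) (S' : {set B2 * C2}) :
  rcomp (rblock R' X' S') (rblock R X S) =
  rblock (rcomp R' R) (rcomp R' X :|: rcomp X' S) (rcomp S' S).
Proof.
apply/setP=> -[a c]; apply/rcompP/idP.
  move=> [b]; case: a b c => [a|a] [b|b] [c|c]; rewrite !in_rblock // => h h'.
  - by apply/rcompP; exists b.
  - by rewrite in_setU; apply/orP; left; apply/rcompP; exists b.
  - by rewrite in_setU; apply/orP; right; apply/rcompP; exists b.
  - by apply/rcompP; exists b.
case: a c => [a|a] [c|c]; rewrite in_rblock //.
- by case/rcompP => b ab bc; exists (inl b); rewrite in_rblock.
- rewrite in_setU => /orP[] /rcompP[b ab bc].
    by exists (inl b); rewrite in_rblock.
  by exists (inr b); rewrite in_rblock.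
by case/rcompP => b ab bc; exists (inr b); rewrite in_rblock.
Qed.

(** The block matrix is triangular: no step leads from the left summand to the right one, so a path
    uses [X] at most once, after a path in [S] and before a path in [R]. *)
Lemma rstar_rblock (A1 A2 : finType)
    (R : {set A1 * A1}) (X : {set A2 * A1}) (S : {set A2 * A2}) :
  rstar (rblock R X S) =
  rblock (rstar R) (rcomp (rstar R) (rcomp X (rstar S))) (rstar S).
Proof.
have lA x y : (x, y) \in rstar R -> (inl x, inl y) \in rstar (rblock R X S).
  move=> h; elim/rstar_ind: x y / h => [x|x y z xy _]; first exact: rstar_refl.
  by apply: rstar_cons; rewrite in_rblock.
have lB x y : (x, y) \in rstar S -> (inr x, inr y) \in rstar (rblock R X S).
  move=> h; elim/rstar_ind: x y / h => [x|x y z xy _]; first exact: rstar_refl.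
  by apply: rstar_cons; rewrite in_rblock.
apply/setP=> -[x y]; apply/idP/idP.
  move=> h; elim/rstar_ind: x y / h => [[x|x]|]; rewrite ?in_rblock ?rstar_refl //.
  move=> x y z xy _; case: x y z xy => [x|x] [y|y] [z|z]; rewrite !in_rblock //.
  - exact: rstar_cons.
  - move=> xy yz; apply/rcompP; exists y => //; apply/rcompP; exists x => //.
    exact: rstar_refl.
  - move=> xy /rcompP[u /rcompP[v yv vu] uz]; apply/rcompP; exists u => //.
    apply/rcompP; exists v => //; exact: rstar_cons yv.
  - exact: rstar_cons.
case: x y => [x|x] [y|y]; rewrite in_rblock //; do ?[exact: lA|exact: lB].
case/rcompP=> u /rcompP[v /lB xv vu] /lA uy.
by apply: rstar_cat xv (rstar_cons _ uy); rewrite in_rblock.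
Qed.

End RelationAlgebra.

Section Trajectory.
Variables (A B : finType) (r : {set A * B}) (m : {set B * A}).
(** Trajectories by the sides of their ends: [traj] is the rule of the boundary before restriction,
    and [trajOI] is [omega] on one sort (vertices or edges). *)
Definition trajI := rstar (rcomp m r).
Definition trajO := rstar (rcomp r m).
Definition traj := rcomp r trajI.
Definition trajOI := rcomp m trajO.

Lemma trajE : traj = rcomp trajO r.
Proof. by rewrite /traj /trajO rstar_slide. Qed.

Lemma trajIE : trajI = rid A :|: rcomp m traj.
Proof.
rewrite /trajI rstarE; congr setU; rewrite trajE /trajO.
by rewrite [RHS]rcompA [LHS]rcompA rstar_slide.
Qed.

End Trajectory.

Lemma traj_m0 (A B : finType) (r : {set A * B}) :
  [/\ trajI r set0 = rid A, trajO r set0 = rid B, traj r set0 = r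
    & trajOI r set0 = set0].
Proof.
have eI : trajI r set0 = rid A by rewrite /trajI rcomp0l rstar0.
split=> //; first by rewrite /trajO rcomp0r rstar0.
  by rewrite /traj eI rcomp1r.
by rewrite /trajOI rcomp0l.
Qed.

Section Blocks.
Variables (IA OA IB OB : finType).
Variables (rA : {set IA * OA}) (mA : {set OA * IA}).
Variables (rB : {set IB * OB}) (mB : {set OB * IB}) (x : {set OB * IA}).
Let r := rblock rA set0 rB.
Let m := rblock mA x mB.

Lemma trajI_block : trajI r m =
  rblock (trajI rA mA) (rcomp (trajI rA mA) (rcomp x (traj rB mB))) (trajI rB mB).
Proof.
by rewrite /trajI rcomp_rblock rstar_rblock rcomp0r set0U -rcompA.
Qed.

Lemma trajO_block : trajO r m =
  rblock (trajO rA mA) (rcomp (traj rA mA) (rcomp x (trajO rB mB))) (trajO rB mB).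
Proof.
by rewrite /trajO rcomp_rblock rstar_rblock rcomp0l setU0 trajE /trajO !rcompA.
Qed.

Lemma traj_block : traj r m =
  rblock (traj rA mA) (rcomp (traj rA mA) (rcomp x (traj rB mB))) (traj rB mB).
Proof.
by rewrite {1}/traj trajI_block rcomp_rblock rcomp0l setU0 !rcompA.
Qed.

(** After crossing [x], a trajectory either stops or continues with [traj rA mA] and a step of [mA].
    The block product lists these two cases separately, and [trajIE] merges them into
    [trajI rA mA]. *)
Lemma trajOI_block : trajOI r m =
  rblock (trajOI rA mA) (rcomp (trajI rA mA) (rcomp x (trajO rB mB))) (trajOI rB mB).
Proof.
rewrite /trajOI trajO_block rcomp_rblock; congr rblock.
by rewrite trajIE rcompUl rcomp1l setUC !rcompA.
Qed.

End Blocks.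
(** * Reduced boundaries *)

(** Sources and targets are indexed by a boolean so that each argument about ends is made once. *)
Definition ep (G : pregraph) (b : bool) : edge G -> option (vert G) :=
  if b then @src G else @tgt G.

Lemma is_graphP G : is_graph G <-> forall (e : edge G) b, exists v, ep b e = Some v.
Proof.
split=> [gG e b|h e].
  have := gG e; rewrite /dangling /ep; case: b; case: (src e) (tgt e) => [u|] [v|] //= _;
  by [exists u|exists v].
by have [u hu] := h e true; have [v hv] := h e false;
  rewrite /dangling; move: hu hv => /= -> ->.
Qed.

Lemma graph_isoP G H f : @graph_iso G H f <->
  [/\ bijective f.1, bijective f.2 & forall b e, ep b (f.2 e) = omap f.1 (ep b e)].
Proof.
split=> [[f1 f2 s t]|[f1 f2 st]]; split=> //; first by case.
  exact: st true.
exact: st false.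
Qed.

Lemma option_ext (A : Type) (o o' : option A) :
  (forall v, o = Some v <-> o' = Some v) -> o = o'.
Proof.
case: o o' => [x|] [y|] h //; first by rewrite (iffLR (h x)).
  by rewrite (iffLR (h x)).
by rewrite (iffRL (h y)).
Qed.

(* One half (input or output) of the passage from a diagram to its reduced
   boundary: [G'] is embedded by [jV], [jE] onto the unmatched vertices [UV] and
   the unmatched edges [UE] (only the non-dangling ones if [del]), and the ends of
   an edge are moved along the trajectories [S]. *)
Definition has_ends (G : pregraph) (UV : pred (vert G))
    (S : {set vert G * vert G}) (e : edge G) : Prop :=
  forall b, exists v u, [/\ ep b e = Some u, UV v & (v, u) \in S].

Definition no_dangling (G : pregraph) (UV : pred (vert G)) (UE : pred (edge G))
    (S : {set vert G * vert G}) : Prop := forall e, UE e -> has_ends UV S e.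

Record bside (del : bool) (G G' : pregraph) (UV : pred (vert G)) (UE : pred (edge G))
    (S : {set vert G * vert G})
    (jV : vert G' -> vert G) (jE : edge G' -> edge G) : Prop := Bside {
  bs_injV : injective jV;
  bs_injE : injective jE;
  bs_imV : forall v, (exists x, jV x = v) <-> UV v;
  bs_imE : forall e, (exists x, jE x = e) <-> UE e /\ (del -> has_ends UV S e);
  bs_ep : forall b x v, ep b x = Some v <->
    exists2 u, ep b (jE x) = Some u & (jV v, u) \in S }.

Section Bside.
Variables (del : bool) (G G' : pregraph) (UV : pred (vert G)) (UE : pred (edge G)).
Variables (S : {set vert G * vert G}).
Variables (jV : vert G' -> vert G) (jE : edge G' -> edge G).
Hypothesis J : bside del UV UE S jV jE.

Lemma bs_UV v : UV (jV v).
Proof. by apply/(bs_imV J); exists v. Qed.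

Lemma bs_UE e : UE (jE e).
Proof. by have [|//] := (bs_imE J (jE e)).1; exists e. Qed.

Lemma bs_has_ends x : has_ends UV S (jE x) <-> forall b, exists v, ep b x = Some v.
Proof.
split=> h b.
  have [v [u [eu /(bs_imV J)[w <-] wu]]] := h b.
  by exists w; apply/(bs_ep J); exists u.
have [v /(bs_ep J)[u eu vu]] := h b.
by exists (jV v), u; split=> //; apply: bs_UV.
Qed.

(** Turns the test made by [projP] on a boundary into a condition on the original side, where it can
    be followed through a composition. *)
Lemma bside_graph : is_graph G' <-> (del \/ no_dangling UV UE S).
Proof.
split=> [/is_graphP gG|].
  case: del J => [|] J'; [by left|right=> e he].
  have [x <-] : exists x, jE x = e by apply/(bs_imE J').
  by apply/bs_has_ends => b; apply: gG.
move=> h; apply/is_graphP => e; apply/bs_has_ends.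
have [|he d] := (bs_imE J (jE e)).1; first by exists e.
by case: h => [/d|]; last apply.
Qed.

Lemma bside_true : is_graph G' -> bside true UV UE S jV jE.
Proof.
case: J => iV iE imV imE hep /is_graphP gG; split=> // e.
rewrite imE; split=> -[he h]; split=> // _; last by apply: h.
have /imE [x <-] := conj he h; exact/bs_has_ends/gG.
Qed.

Lemma bside_del :
  @bside true G (del_dangling G') UV UE S jV (jE \o val).
Proof.
have dP x : ~~ dangling x <-> has_ends UV S (jE x).
  rewrite bs_has_ends /dangling; split=> [|h].
    case hs: (src x) => [u|] //; case ht: (tgt x) => [v|] // _ [].
      by exists u.
    by exists v.
  by have [/= u ->] := h true; have [/= v ->] := h false.
split.
- exact: bs_injV J.
- by apply: inj_comp (bs_injE J) _; apply: val_inj.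
- exact: bs_imV J.
- move=> e; split=> [[x <-]|[he h]].
    by split; [apply: bs_UE|move=> _; apply/dP/(valP x)].
  have /(bs_imE J)[x xe] : UE e /\ (del -> has_ends UV S e) by split=> // _; apply: h.
  have dx : ~~ dangling x by apply/dP; rewrite xe; apply: h.
  by exists (Sub x dx).
by move=> b x v; rewrite -(bs_ep J); case: b.
Qed.

Lemma bside_iso_dst H f : @graph_iso G' H f ->
  exists jV' jE', @bside del G H UV UE S jV' jE' /\
    (forall v, jV' (f.1 v) = jV v) /\ (forall e, jE' (f.2 e) = jE e).
Proof.
move=> /graph_isoP[[g1 K1 L1] [g2 K2 L2] fE].
exists (jV \o g1), (jE \o g2); split; last by split=> x /=; rewrite ?K1 ?K2.
split=> [|||| b x v].
- by apply: inj_comp (bs_injV J) (can_inj L1).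
- by apply: inj_comp (bs_injE J) (can_inj L2).
- move=> v; rewrite -(bs_imV J).
  by split=> -[x <-]; [exists (g1 x)|exists (f.1 x); rewrite /= K1].
- move=> v; rewrite -(bs_imE J).
  by split=> -[x <-]; [exists (g2 x)|exists (f.2 x); rewrite /= K2].
rewrite /= -(bs_ep J) -{1}[x]L2 fE.
by case: (ep b _) => [w|] //=; split=> -[]; [move=> <-|move=> ->]; rewrite ?K1 ?L1.
Qed.

Lemma bside_iso_src H f (UV' : pred (vert H)) (UE' : pred (edge H))
    (S' : {set vert H * vert H}) : @graph_iso G H f ->
  (forall v, UV' (f.1 v) = UV v) -> (forall e, UE' (f.2 e) = UE e) ->
  (forall u v, ((f.1 u, f.1 v) \in S') = ((u, v) \in S)) ->
  @bside del H G' UV' UE' S' (f.1 \o jV) (f.2 \o jE).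
Proof.
move=> /graph_isoP[[g1 K1 L1] [g2 K2 L2] fE] hV hE hS.
have endsE e : has_ends UV' S' (f.2 e) <-> has_ends UV S e.
  split=> h b; have [v [u [eu hv vu]]] := h b.
    move: eu; rewrite fE; case eu: (ep b e) => [w|] //= [wu]; rewrite -wu in vu.
    by exists (g1 v), w; split=> //; rewrite -?hV -?hS L1.
  by exists (f.1 v), (f.1 u); split; rewrite ?hV ?hS // fE eu.
split=> [||v|e|b x v].
- by apply: inj_comp (bs_injV J); apply: can_inj K1.
- by apply: inj_comp (bs_injE J); apply: can_inj K2.
- rewrite -[v]L1 hV -(bs_imV J).
  by split=> -[x /= h]; exists x; [apply: (can_inj K1)|rewrite /= h].
- rewrite -[e]L2 hE endsE -(bs_imE J).
  by split=> -[x /= h]; exists x; [apply: (can_inj K2)|rewrite /= h].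
rewrite (bs_ep J) /= fE; split=> -[u].
  by move=> -> vu; exists (f.1 u); rewrite ?hS.
by case: (ep b _) => [w|] //= [<-]; rewrite hS; exists w.
Qed.

End Bside.

(** Both embeddings have the same image, fixed in terms of [G] alone, so each factors through the
    other; the ends agree because [bs_ep] describes them inside [G]. *)
Lemma bside_uniq del G G1 G2 UV UE S jV1 jE1 jV2 jE2 :
  @bside del G G1 UV UE S jV1 jE1 -> @bside del G G2 UV UE S jV2 jE2 ->
  exists2 f, graph_iso f &
    (forall v, jV2 (f.1 v) = jV1 v) /\ (forall e, jE2 (f.2 e) = jE1 e).
Proof.
have half H1 H2 iV1 iE1 iV2 iE2 : @bside del G H1 UV UE S iV1 iE1 ->
    @bside del G H2 UV UE S iV2 iE2 -> exists f : _ * _,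
    (forall v, iV2 (f.1 v) = iV1 v) /\ (forall e, iE2 (f.2 e) = iE1 e).
  move=> J1 J2.
  have /choice[f hf] : forall x, exists y, iV2 y = iV1 x.
    by move=> x; apply/(bs_imV J2)/(bs_imV J1); exists x.
  have /choice[g hg] : forall x, exists y, iE2 y = iE1 x.
    by move=> x; apply/(bs_imE J2)/(bs_imE J1); exists x.
  by exists (f, g).
move=> J1 J2; have [f [f1 f2]] := half _ _ _ _ _ _ J1 J2.
have [g [g1 g2]] := half _ _ _ _ _ _ J2 J1; exists f => //.
apply/graph_isoP; split=> [||b e].
- by exists g.1 => x; [apply: (bs_injV J1)|apply: (bs_injV J2)]; rewrite ?g1 ?f1 ?g1.
- by exists g.2 => x; [apply: (bs_injE J1)|apply: (bs_injE J2)]; rewrite ?g2 ?f2 ?g2.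
apply: option_ext => v; rewrite (bs_ep J2) f2.
have -> : (omap f.1 (ep b e) = Some v) <-> ep b e = Some (g.1 v).
  case: (ep b e) => [w|] //=; split=> -[].
    by move=> <-; congr Some; apply: (bs_injV J1); rewrite g1 f1.
  by move=> ->; congr Some; apply: (bs_injV J2); rewrite f1 g1.
by rewrite (bs_ep J1) g1.
Qed.

Section BsideComp.
Variables (del : bool) (G H C : pregraph).
Variables (U1V UV : pred (vert G)) (U1E UE : pred (edge G)).
Variables (S1 S : {set vert G * vert G}).
Variables (jV : vert H -> vert G) (jE : edge H -> edge G).
Variables (U'V : pred (vert H)) (U'E : pred (edge H)) (S' : {set vert H * vert H}).
Hypothesis J1 : bside true U1V U1E S1 jV jE.
Hypothesis subV : forall v, UV v -> U1V v.
Hypothesis subE : forall e, UE e -> U1E e.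
Hypothesis pullV : forall v, UV (jV v) = U'V v.
Hypothesis pullE : forall e, UE (jE e) = U'E e.
Hypothesis factor : forall x w,
  (jV x, w) \in S <-> exists2 y, (x, y) \in S' & (jV y, w) \in S1.

Lemma has_ends_comp e : has_ends UV S (jE e) <-> has_ends U'V S' e.
Proof.
split=> h b; have [v [u [eu hv vu]]] := h b.
  have /(bs_imV J1)[x xv] := subV hv; rewrite -xv in hv vu.
  move: vu => /factor[y xy yu]; exists x, y; split=> //; last by rewrite -pullV.
  by apply/(bs_ep J1); exists u.
move: eu => /(bs_ep J1)[w ew uw]; exists (jV v), w; rewrite pullV; split=> //.
by apply/factor; exists u.
Qed.

(** The intermediate vertex [y] given by [factor] serves as an unmatched end of [e] in the first
    stage, so an edge that keeps its ends through both stages is not deleted by the first. *)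
Lemma has_ends_sub e : U1E e -> has_ends UV S e -> exists x, jE x = e.
Proof.
move=> he h; apply/(bs_imE J1); split=> // _ b; have [v [u [eu hv vu]]] := h b.
have /(bs_imV J1)[x xv] := subV hv; rewrite -xv in hv vu.
by move: vu => /factor[y xy yu]; exists (jV y), u; split=> //; apply: bs_UV J1 _.
Qed.

(** Two reductions compose because [factor] splits each pair of [S] starting at an embedded vertex
    into a pair of [S'] on the reduced side and a pair of [S1]. *)
Lemma bside_comp jV' jE' : @bside true H C U'V U'E S' jV' jE' ->
  bside true UV UE S (jV \o jV') (jE \o jE').
Proof.
move=> J2; split=> [||v|e|b x v].
- by apply: inj_comp (bs_injV J1) (bs_injV J2).
- by apply: inj_comp (bs_injE J1) (bs_injE J2).
- split=> [[x <-]|hv]; first by rewrite /= pullV; apply: bs_UV J2 _.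
  have /(bs_imV J1)[x xv] := subV hv; rewrite -xv pullV in hv.
  by have /(bs_imV J2)[y yx] := hv; exists y; rewrite /= yx.
- split=> [[x <-]|[he hd]].
    have [|hE hd] := (bs_imE J2 (jE' x)).1; first by exists x.
    by rewrite /= pullE; split=> // _; apply/has_ends_comp/hd.
  have [y ye] := has_ends_sub (subE he) (hd isT).
  have [|x xy] := (bs_imE J2 y).2; last by exists x; rewrite /= xy.
  by rewrite -pullE ye; split=> // _; apply/has_ends_comp; rewrite ye; apply: hd.
rewrite (bs_ep J2); split=> -[u].
  move=> /(bs_ep J1)[w ew uw] vu; exists w => //.
  by apply/factor; exists u.
move=> eu /factor[y vy yu]; exists y => //.
by apply/(bs_ep J1); exists u.
Qed.

Hypothesis matched : forall e, U1E e -> ~~ UE e -> exists x, jE x = e.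

Lemma no_dangling_comp : no_dangling UV UE S <->
  no_dangling U1V U1E S1 /\ no_dangling U'V U'E S'.
Proof.
split=> [h|[h1 h2] e he].
  split=> [e he|e]; last by rewrite -pullE => /h/has_ends_comp.
  (* An edge that is still free at the end has ends by [h]; one consumed by the second stage is
     covered by [matched]. Either way it survives the first stage. *)
  have [x <-] : exists x, jE x = e.
    case: (boolP (UE e)) => [/h|]; [exact: has_ends_sub|exact: matched].
  by have [|_ ] := (bs_imE J1 (jE x)).1; [exists x|apply].
have [|x xe] := (bs_imE J1 e).2; first by split; [apply: subE|move=> _; apply/h1/subE].
by rewrite -xe; apply/has_ends_comp/h2; rewrite -pullE xe.
Qed.

End BsideComp.

(** * Transport of trajectories along bijections *)

Section Pull.

Lemma pull_rcomp (A B C A' B' C' : finType) (f : A' -> A) (g : B' -> B)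
    (h : C' -> C) (S : {set B * C}) (R : {set A * B}) : bijective g ->
  pull f h (rcomp S R) = rcomp (pull g h S) (pull f g R).
Proof.
move=> [g' K L]; apply/setP=> -[a c]; rewrite in_pull.
apply/rcompP/rcompP => -[b]; last by rewrite !in_pull; exists (g b).
by exists (g' b); rewrite in_pull L.
Qed.

Lemma pull_rstar (A A' : finType) (f : A' -> A) (R : {set A * A}) : bijective f ->
  pull f f (rstar R) = rstar (pull f f R).
Proof.
move=> [f' K L]; apply/setP=> -[a c]; rewrite in_pull; apply/idP/idP.
  rewrite -{2}[a]K -{2}[c]K; move: (f a) (f c) => x y h.
  elim/rstar_ind: x y / h => [x|x y z xy _]; first exact: rstar_refl.
  by apply: rstar_cons; rewrite in_pull !L.
move=> h; elim/rstar_ind: a c / h => [x|x y z xy _]; first exact: rstar_refl.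
by apply: rstar_cons; rewrite in_pull in xy.
Qed.

Lemma rim_pull (A B A' B' : finType) (f : A' -> A) (g : B' -> B) (R : {set A * B}) y :
  bijective f -> (y \in rim (pull f g R)) = (g y \in rim R).
Proof.
move=> [f' K L]; apply/rimP/rimP => -[x h]; last by exists (f' x); rewrite in_pull L.
by exists (f x); rewrite in_pull in h.
Qed.

Lemma rdom_pull (A B A' B' : finType) (f : A' -> A) (g : B' -> B) (R : {set A * B}) x :
  bijective g -> (x \in rdom (pull f g R)) = (f x \in rdom R).
Proof.
move=> [g' K L]; apply/rdomP/rdomP => -[y h]; last by exists (g' y); rewrite in_pull L.
by exists (g y); rewrite in_pull in h.
Qed.

Section PullTraj.
Variables (A B A' B' : finType) (f : A' -> A) (g : B' -> B).
Variables (r : {set A * B}) (m : {set B * A}).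
Hypotheses (fB : bijective f) (gB : bijective g).

Lemma pull_trajI : pull f f (trajI r m) = trajI (pull f g r) (pull g f m).
Proof. by rewrite /trajI pull_rstar // (pull_rcomp _ _ _ _ gB). Qed.

Lemma pull_trajO : pull g g (trajO r m) = trajO (pull f g r) (pull g f m).
Proof. by rewrite /trajO pull_rstar // (pull_rcomp _ _ _ _ fB). Qed.

Lemma pull_traj : pull f g (traj r m) = traj (pull f g r) (pull g f m).
Proof. by rewrite /traj (pull_rcomp _ _ _ _ fB) pull_trajI. Qed.

Lemma pull_trajOI : pull g f (trajOI r m) = trajOI (pull f g r) (pull g f m).
Proof. by rewrite /trajOI (pull_rcomp _ _ _ _ gB) pull_trajO. Qed.

End PullTraj.

Lemma rel_iso_pull G H G' H' f g R R' : @rel_iso G H G' H' f g R R' <->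
  R = (pull f.1 g.1 R'.1, pull f.2 g.2 R'.2).
Proof.
split=> [[h1 h2]|->]; last by split=> x y /=; rewrite in_pull.
by case: R h1 h2 => R1 R2 h1 h2; congr pair; apply/setP=> -[x y]; rewrite in_pull ?h1 ?h2.
Qed.

End Pull.

(* Both [sideI] and [sideO] relate an unmatched vertex to the vertices whose
   trajectory leads to it, hence the converse for outputs. *)
Section Sides.
Variable d : diagram.
Definition freeIV : pred (vert (inp d)) := fun v => v \notin rim (mm d).1.
Definition freeIE : pred (edge (inp d)) := fun e => e \notin rim (mm d).2.
Definition freeOV : pred (vert (out d)) := fun v => v \notin rdom (mm d).1.
Definition freeOE : pred (edge (out d)) := fun e => e \notin rdom (mm d).2.
Definition sideI := trajI (rr d).1 (mm d).1.
Definition sideO := rconv (trajO (rr d).1 (mm d).1).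
End Sides.
Arguments freeIV : clear implicits.
Arguments freeIE : clear implicits.
Arguments freeOV : clear implicits.
Arguments freeOE : clear implicits.

(* [d'] is [d] reduced to its boundary, with deletion of the dangling edges of
   the input if [bI] and of the output if [bO]. *)
Record reduction (bI bO : bool) (d d' : diagram)
    (iV : vert (inp d') -> vert (inp d)) (iE : edge (inp d') -> edge (inp d))
    (oV : vert (out d') -> vert (out d)) (oE : edge (out d') -> edge (out d)) :
    Prop := Reduction {
  red_inp : bside bI (freeIV d) (freeIE d) (sideI d) iV iE;
  red_out : bside bO (freeOV d) (freeOE d) (sideO d) oV oE;
  red_rV : (rr d').1 = pull iV oV (traj (rr d).1 (mm d).1);
  red_rE : (rr d').2 = pull iE oE (traj (rr d).2 (mm d).2);
  red_mm : mm d' = grel0 _ _ }.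

Definition reduct bI bO d d' : Prop :=
  exists iV iE oV oE, @reduction bI bO d d' iV iE oV oE.

Lemma reduct_isor bI bO d d1 d2 : diagram_iso d1 d2 ->
  reduct bI bO d d1 -> reduct bI bO d d2.
Proof.
move=> [f [g [fI gI /rel_iso_pull rE /rel_iso_pull mE]]].
move=> [iV [iE [oV [oE [jI jO hV hE m0]]]]].
have [iV' [iE' [jI' [iVE iEE]]]] := bside_iso_dst jI fI.
have [oV' [oE' [jO' [oVE oEE]]]] := bside_iso_dst jO gI.
exists iV', iE', oV', oE'; split=> //.
- case: fI gI => [[f1 _ F1] _ _ _] [[g1 _ G1] _ _ _].
  apply/setP=> -[x y]; rewrite in_pull -[x]F1 -[y]G1 iVE oVE.
  by have /setP/(_ (f1 x, g1 y)) := hV; rewrite rE !in_pull.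
- case: fI gI => [_ [f1 _ F1] _ _] [_ [g1 _ G1] _ _].
  apply/setP=> -[x y]; rewrite in_pull -[x]F1 -[y]G1 iEE oEE.
  by have /setP/(_ (f1 x, g1 y)) := hE; rewrite rE !in_pull.
rewrite m0 in mE; case: fI gI mE => [[f1 _ F1] [f2 _ F2] _ _] [[g1 _ G1] [g2 _ G2] _ _].
case: (mm d2) => m1 m2 [/setP e1 /setP e2].
congr pair; apply/setP=> -[x y]; rewrite in_set0.
  by have := e1 (g1 x, f1 y); rewrite in_pull in_set0 F1 G1.
by have := e2 (g2 x, f2 y); rewrite in_pull in_set0 F2 G2.
Qed.

Lemma reduct_isol bI bO d1 d2 d : diagram_iso d1 d2 ->
  reduct bI bO d1 d -> reduct bI bO d2 d.
Proof.
move=> [f [g [fI gI /rel_iso_pull rE /rel_iso_pull mE]]].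
move=> [iV [iE [oV [oE [jI jO hV hE m0]]]]].
have [f1 f2 _ _] := fI; have [g1 g2 _ _] := gI.
exists (f.1 \o iV), (f.2 \o iE), (g.1 \o oV), (g.2 \o oE); split=> //.
- apply: (bside_iso_src jI fI) => [v|e|u v].
  + by rewrite /freeIV mE /= rim_pull.
  + by rewrite /freeIE mE /= rim_pull.
  by rewrite /sideI mE rE /= -pull_trajI // in_pull.
- apply: (bside_iso_src jO gI) => [v|e|u v].
  + by rewrite /freeOV mE /= rdom_pull.
  + by rewrite /freeOE mE /= rdom_pull.
  by rewrite /sideO mE rE /= -pull_trajO // !in_rconv in_pull.
- rewrite hV mE rE /= -pull_traj //.
  by apply/setP=> -[x y]; rewrite !in_pull.
rewrite hE mE rE /= -pull_traj //.
by apply/setP=> -[x y]; rewrite !in_pull.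
Qed.

Lemma reduct_uniq bI bO d d1 d2 :
  reduct bI bO d d1 -> reduct bI bO d d2 -> diagram_iso d1 d2.
Proof.
move=> [iV [iE [oV [oE [jI jO hV hE m0]]]]].
move=> [iV' [iE' [oV' [oE' [jI' jO' hV' hE' m0']]]]].
have [f fI [f1 f2]] := bside_uniq jI jI'; have [g gI [g1 g2]] := bside_uniq jO jO'.
exists f, g; split=> //; apply/rel_iso_pull.
  rewrite hV' hE'; case: (rr d1) hV hE => r1 r2 /= -> ->.
  by congr pair; apply/setP=> -[x y]; rewrite !in_pull ?f1 ?f2 ?g1 ?g2.
by rewrite m0 m0'; congr pair; apply/setP=> -[x y]; rewrite in_pull !in_set0.
Qed.

Lemma reduct_spoA bI bO d d' : reduct bI bO d d' -> reduct bI true d (spoA d').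
Proof.
move=> [iV [iE [oV [oE [jI jO hV hE m0]]]]].
exists iV, iE, oV, (oE \o val); split=> //; first exact: bside_del jO.
  by rewrite /= hE; apply/setP=> -[x y]; rewrite !in_pull.
by rewrite /= m0; congr pair; apply/setP=> -[x y]; rewrite in_pull !in_set0.
Qed.

Lemma reduct_spoB bI bO d d' : reduct bI bO d d' -> reduct true bO d (spoB d').
Proof.
move=> [iV [iE [oV [oE [jI jO hV hE m0]]]]].
exists iV, (iE \o val), oV, oE; split=> //; first exact: bside_del jI.
  by rewrite /= hE; apply/setP=> -[x y]; rewrite !in_pull.
by rewrite /= m0; congr pair; apply/setP=> -[x y]; rewrite in_pull !in_set0.
Qed.

(** The uniqueness hypothesis makes the vertex picked by [endpoint] the only candidate, so that the
    ends in [grestr] do not depend on a choice. *)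
Lemma bside_grestr (G : pregraph) (PV : pred (vert G)) (PE : pred (edge G))
    (R : {set vert G * vert G}) :
  (forall u v v', PV v -> PV v' -> (u, v) \in R -> (u, v') \in R -> v = v') ->
  @bside false G (grestr PV PE R) PV PE (rconv R) val val.
Proof.
move=> uniqR; split=> [||v|e|b x v].
- exact: val_inj.
- exact: val_inj.
- by split=> [[x <-]|h]; [apply: (valP x)|exists (Sub v h)].
- by split=> [[x <-]|[h _]]; [split=> //; apply: (valP x)|exists (Sub e h)].
have -> : ep b x = endpoint PV R (ep b (val x)) by case: b.
case: (ep b (val x)) => [u|] /=; last by split=> // -[].
case: pickP => [w uw|none].
  split=> [[<-]|[_ [<-]]]; first by exists u; rewrite // in_rconv.
  rewrite in_rconv => uv; congr Some; apply: val_inj.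
  exact: uniqR (valP w) (valP v) uw uv.
by split=> // -[_ [<-]]; rewrite in_rconv none.
Qed.

(** One-to-one relations make trajectories deterministic in both directions, and unmatched vertices
    are where they stop. Hence at most one unmatched vertex is reached, as [bside_grestr]
    requires. *)
Lemma reduct_bdry d : gone_to_one (rr d) -> gone_to_one (mm d) ->
  reduct false false d (bdry d).
Proof.
move=> [r1 r2] [m1 m2]; exists val, val, val, val.
have [rf ri] := (one_to_oneP _).1 r1; have [mf mi] := (one_to_oneP _).1 m1.
split=> //.
- have -> : sideI d = rconv (gstar (gconv (rr d) \og gconv (mm d))).1.
    rewrite /sideI /trajI /= rconv_rcomp rconv_rstar.
    by apply/setP=> -[x y]; rewrite !in_rconv.
  apply: bside_grestr => u v v' hv hv'.
  rewrite /= rconv_rcomp !in_set /= => h h'.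
  have ini y : y \notin rim (mm d).1 -> forall w, (y, w) \notin rconv (rcomp (mm d).1 (rr d).1).
    move=> ym w; rewrite in_rconv; apply/rcompP => -[c wc cy]; case/negP: ym.
    by apply/rimP; exists c.
  apply: terminal_uniq h h' (ini _ hv) (ini _ hv') => x y z.
  rewrite !in_rconv => /rcompP[c yc cx] /rcompP[c' zc' cx'].
  by rewrite (mi _ _ _ cx cx') in yc; apply: ri yc zc'.
apply: bside_grestr => u v v' hv hv'; rewrite !inE /= => h h'.
have ini y : y \notin rdom (mm d).1 -> forall w, (y, w) \notin rcomp (rr d).1 (mm d).1.
  move=> ym w; apply/rcompP => -[c yc cw]; case/negP: ym.
  by apply/rdomP; exists c.
apply: terminal_uniq h h' (ini _ hv) (ini _ hv') => x y z.
move=> /rcompP[c xc cy] /rcompP[c' xc' cz].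
by rewrite (mf _ _ _ xc xc') in cy; apply: rf cy cz.
Qed.
(** * Composition and matchings *)

Lemma compatibleP G H (R : grel G H) : compatible R <->
  forall e e' b v v', (e, e') \in R.2 -> ep b e = Some v -> ep b e' = Some v' ->
    (v, v') \in R.1.
Proof.
split=> [h e e' b v v' /h[s t]|h e e' ee']; last split=> v v'.
- by case: b; [apply: s|apply: t].
- exact: (h e e' true).
exact: (h e e' false).
Qed.

Lemma ep_inl G H b (e : edge G) : @ep (gsum G H) b (inl e) = omap inl (ep b e).
Proof. by case: b. Qed.

Lemma ep_inr G H b (e : edge H) : @ep (gsum G H) b (inr e) = omap inr (ep b e).
Proof. by case: b. Qed.

Lemma is_graph_gsum G H : is_graph (gsum G H) <-> is_graph G /\ is_graph H.
Proof.
split=> [h|[hG hH] [e|e]].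
- by split=> e; [have := h (inl e)|have := h (inr e)]; rewrite /dangling /=;
    case: (src e); case: (tgt e).
- by have := hG e; rewrite /dangling /=; case: (src e); case: (tgt e).
by have := hH e; rewrite /dangling /=; case: (src e); case: (tgt e).
Qed.

Lemma rim_rblock_l (A1 A2 B1 B2 : finType) (R : {set A1 * B1}) (X : {set A2 * B1})
  (S : {set A2 * B2}) b : (inl b \in rim (rblock R X S)) = (b \in rim R) || (b \in rim X).
Proof.
apply/rimP/orP => [[[a|a]]|[/rimP[a h]|/rimP[a h]]].
- by rewrite in_rblock => h; left; apply/rimP; exists a.
- by rewrite in_rblock => h; right; apply/rimP; exists a.
- by exists (inl a); rewrite in_rblock.
by exists (inr a); rewrite in_rblock.
Qed.

Lemma rim_rblock_r (A1 A2 B1 B2 : finType) (R : {set A1 * B1}) (X : {set A2 * B1})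
  (S : {set A2 * B2}) b : (inr b \in rim (rblock R X S)) = (b \in rim S).
Proof.
apply/rimP/rimP => [[[a|a]]|[a h]]; last by exists (inr a); rewrite in_rblock.
  by rewrite in_rblock.
by rewrite in_rblock; exists a.
Qed.

Lemma rdom_rblock_l (A1 A2 B1 B2 : finType) (R : {set A1 * B1}) (X : {set A2 * B1})
  (S : {set A2 * B2}) a : (inl a \in rdom (rblock R X S)) = (a \in rdom R).
Proof.
apply/rdomP/rdomP => [[[b|b]]|[b h]]; last by exists (inl b); rewrite in_rblock.
  by rewrite in_rblock; exists b.
by rewrite in_rblock.
Qed.

Lemma rdom_rblock_r (A1 A2 B1 B2 : finType) (R : {set A1 * B1}) (X : {set A2 * B1})
  (S : {set A2 * B2}) a : (inr a \in rdom (rblock R X S)) = (a \in rdom X) || (a \in rdom S).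
Proof.
apply/rdomP/orP => [[[b|b]]|[/rdomP[b h]|/rdomP[b h]]].
- by rewrite in_rblock => h; left; apply/rdomP; exists b.
- by rewrite in_rblock => h; right; apply/rdomP; exists b.
- by exists (inl b); rewrite in_rblock.
by exists (inr b); rewrite in_rblock.
Qed.

(** When the blocks are the matches of a composite, the last clause is what confines the crossing
    matches to the boundaries of the two factors. *)
Lemma one_to_one_rblock (A1 A2 B1 B2 : finType) (R : {set A1 * B1})
    (X : {set A2 * B1}) (S : {set A2 * B2}) :
  one_to_one (rblock R X S) <->
  [/\ one_to_one R, one_to_one X, one_to_one S
    & forall a b, (a, b) \in X -> a \notin rdom S /\ b \notin rim R].
Proof.
split=> [/one_to_oneP[f i]|].
  split; [apply/one_to_oneP; split|apply/one_to_oneP; split|apply/one_to_oneP; split|].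
  - by move=> a b b' h h'; have := f (inl a) (inl b) (inl b'); rewrite !in_rblock => /(_ h h') [].
  - by move=> a a' b h h'; have := i (inl a) (inl a') (inl b); rewrite !in_rblock => /(_ h h') [].
  - by move=> a b b' h h'; have := f (inr a) (inl b) (inl b'); rewrite !in_rblock => /(_ h h') [].
  - by move=> a a' b h h'; have := i (inr a) (inr a') (inl b); rewrite !in_rblock => /(_ h h') [].
  - by move=> a b b' h h'; have := f (inr a) (inr b) (inr b'); rewrite !in_rblock => /(_ h h') [].
  - by move=> a a' b h h'; have := i (inr a) (inr a') (inr b); rewrite !in_rblock => /(_ h h') [].
  move=> a b ab; split; apply/negP.
    move=> /rdomP[b' ab']; have : inl b = inr b' :> B1 + B2; last by [].
    by apply: (f (inr a)); rewrite in_rblock.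
  move=> /rimP[a' ab']; have : inl a' = inr a :> A1 + A2; last by [].
  by apply: i (inl b) _ _; rewrite in_rblock.
move=> [/one_to_oneP[fR iR] /one_to_oneP[fX iX] /one_to_oneP[fS iS] dis].
have noS a b b' : (a, b) \in X -> (a, b') \in S -> False.
  by move=> /dis[/negP ha _] h; apply: ha; apply/rdomP; exists b'.
have noR a a' b : (a, b) \in X -> (a', b) \in R -> False.
  by move=> /dis[_ /negP ha] h; apply: ha; apply/rimP; exists a'.
apply/one_to_oneP; split.
  move=> [a|a] [b|b] [b'|b']; rewrite !in_rblock // => h h'.
  - by rewrite (fR _ _ _ h h').
  - by rewrite (fX _ _ _ h h').
  - by case: (noS _ _ _ h h').
  - by case: (noS _ _ _ h' h).
  by rewrite (fS _ _ _ h h').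
move=> [a|a] [a'|a'] [b|b]; rewrite !in_rblock // => h h'.
- by rewrite (iR _ _ _ h h').
- by case: (noR _ _ _ h' h).
- by case: (noR _ _ _ h h').
- by rewrite (iX _ _ _ h h').
by rewrite (iS _ _ _ h h').
Qed.

Lemma trajOE (A B : finType) (r : {set A * B}) (m : {set B * A}) :
  trajO r m = rid B :|: rcomp r (trajOI r m).
Proof.
by rewrite {1}/trajO rstarE [rcomp (rstar _) _]rcompA rstar_slide -rcompA rstar_slide.
Qed.

(** The numbering is split off because it behaves differently under composition: a composite
    inherits one from its factors, whereas the conditions kept here pass from a composite back to
    its factors. *)
Definition prerule (d : diagram) : Prop :=
  [/\ gone_to_one (rr d) /\ compatible (rr d), gone_to_one (mm d),
      compatible (omega d), is_graph (inp d) & is_graph (out d)].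

Definition numbered d : Prop := exists n (k : item d -> 'I_n), is_numbering k.

Lemma is_rule_diagramE d : is_rule_diagram d <-> prerule d /\ numbered d.
Proof. by split=> [[[rp mp op n] gI gO]|[[rp mp op gI gO] n]]. Qed.

(** The ends of an edge follow it although [mm d] itself need not be compatible: a trajectory is
    empty, or a pair of [omega d] followed by a step of [rr d], and both of these are compatible.
    The intermediate edge has an end because [inp d] is a graph. *)
Lemma trajO_ends d b e e' v v' : prerule d -> (e, e') \in trajO (rr d).2 (mm d).2 ->
  ep b e = Some v -> ep b e' = Some v' -> (v, v') \in trajO (rr d).1 (mm d).1.
Proof.
move=> [[_ /compatibleP rc] _ /compatibleP oc /is_graphP gI _].
rewrite trajOE in_setU in_rid => /orP[/eqP->|/rcompP[i ei ie']].
  by move=> -> [->]; apply: rstar_refl.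
have [w hw] := gI i b; move=> hv hv'; rewrite trajOE in_setU; apply/orP; right.
by apply/rcompP; exists w; [apply: oc ei hv hw|apply: rc ie' hw hv'].
Qed.

Lemma trajI_ends d b e e' v v' : prerule d -> (e, e') \in trajI (rr d).2 (mm d).2 ->
  ep b e = Some v -> ep b e' = Some v' -> (v, v') \in trajI (rr d).1 (mm d).1.
Proof.
move=> [[_ /compatibleP rc] _ /compatibleP oc _ /is_graphP gO].
rewrite trajIE trajE rcompA -/(trajOI _ _) in_setU in_rid => /orP[/eqP->|].
  by move=> -> [->]; apply: rstar_refl.
move=> /rcompP[i ei ie'].
have [w hw] := gO i b; move=> hv hv'; rewrite trajIE trajE rcompA in_setU.
apply/orP; right.
by apply/rcompP; exists w; [apply: rc ei hv hw|apply: oc ie' hw hv'].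
Qed.

(* The third clause says that [omega] of the composite is compatible at [m]. *)
Definition matching (a b : diagram) (m : grel (out b) (inp a)) : Prop :=
  [/\ one_to_one (rblock (mm a).1 m.1 (mm b).1),
      one_to_one (rblock (mm a).2 m.2 (mm b).2)
    & forall f f' c v v', (f, f') \in m.2 -> ep c f = Some v -> ep c f' = Some v' ->
      (v, v') \in rcomp (trajI (rr a).1 (mm a).1)
                        (rcomp m.1 (trajO (rr b).1 (mm b).1))].

Lemma omega_dcomp a b (m : grel (out b) (inp a)) : omega (dcomp m) =
  (rblock (trajOI (rr a).1 (mm a).1) (rcomp (trajI (rr a).1 (mm a).1)
     (rcomp m.1 (trajO (rr b).1 (mm b).1))) (trajOI (rr b).1 (mm b).1),
   rblock (trajOI (rr a).2 (mm a).2) (rcomp (trajI (rr a).2 (mm a).2)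
     (rcomp m.2 (trajO (rr b).2 (mm b).2))) (trajOI (rr b).2 (mm b).2)).
Proof. by rewrite -!trajOI_block. Qed.

Lemma prerule_dcomp a b (m : grel (out b) (inp a)) :
  prerule (dcomp m) <-> [/\ prerule a, prerule b & matching m].
Proof.
split.
  move=> [[[r1 r2] /compatibleP rc] [m1 m2] oc /is_graph_gsum[gIa gIb]].
  move=> /is_graph_gsum[gOa gOb].
  move: r1 r2 (m1) (m2) => /one_to_one_rblock[ra1 _ rb1 _] /one_to_one_rblock[ra2 _ rb2 _].
  move=> /one_to_one_rblock[ma1 _ mb1 _] /one_to_one_rblock[ma2 _ mb2 _].
  move: oc => /compatibleP; rewrite omega_dcomp => oc.
  split.
  - split=> //.
      split=> //; apply/compatibleP => e e' c v v' ee' hv hv'.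
      have := rc (inl e) (inl e') c (inl v) (inl v').
      by rewrite /= !in_rblock !ep_inl hv hv'; apply.
    apply/compatibleP => e e' c v v' ee' hv hv'.
    have := oc (inl e) (inl e') c (inl v) (inl v').
    by rewrite /= !in_rblock !ep_inl hv hv'; apply.
  - split=> //.
      split=> //; apply/compatibleP => e e' c v v' ee' hv hv'.
      have := rc (inr e) (inr e') c (inr v) (inr v').
      by rewrite /= !in_rblock !ep_inr hv hv'; apply.
    apply/compatibleP => e e' c v v' ee' hv hv'.
    have := oc (inr e) (inr e') c (inr v) (inr v').
    by rewrite /= !in_rblock !ep_inr hv hv'; apply.
  split=> // f f' c v v' ff' hv hv'.
  have := oc (inr f) (inl f') c (inr v) (inl v').
  rewrite /= !in_rblock ep_inr ep_inl hv hv'; apply=> //.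
  apply/rcompP; exists f'; last exact: rstar_refl.
  by apply/rcompP; exists f => //; exact: rstar_refl.
move=> [pa pb [m1 m2 mc]]; have [[[ra1 ra2] rca] _ oca gIa gOa] := pa.
have [[[rb1 rb2] rcb] _ ocb gIb gOb] := pb.
split; try by apply/is_graph_gsum.
- split.
    have o0 (A B : finType) : one_to_one (set0 : {set A * B}) by move=> p q; rewrite in_set0.
    by split; apply/one_to_one_rblock; split=> // u w; rewrite in_set0.
  apply/compatibleP => -[e|e] [e'|e'] c v v'; rewrite /= !in_rblock ?in_set0 //.
    rewrite !ep_inl; case hu: (ep c e) => [u|] //; case hw: (ep c e') => [w|] // ee' [<-] [<-].
    by rewrite in_rblock; move/compatibleP: rca; apply; eauto.
  rewrite !ep_inr; case hu: (ep c e) => [u|] //; case hw: (ep c e') => [w|] // ee' [<-] [<-].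
  by rewrite in_rblock; move/compatibleP: rcb; apply; eauto.
- by [].
apply/compatibleP => e e' c v v'; rewrite omega_dcomp /=.
case: e e' => [e|e] [e'|e']; rewrite in_rblock // ?ep_inl ?ep_inr;
  case hu: (ep c e) => [u|] //; case hw: (ep c e') => [w|] // ee' [<-] [<-]; rewrite in_rblock.
- by move/compatibleP: oca; apply; eauto.
(* The mixed block: [matching] controls only the crossing pair [f], [f'], so the ends are carried to
   it along [b] and away from it along [a]. *)
- move: ee' => /rcompP[f' /rcompP[f ef ff'] fe'].
  have [x hx] := (is_graphP _).1 gOb f c; have [y hy] := (is_graphP _).1 gIa f' c.
  have ux := trajO_ends pb ef hu hx; have yw := trajI_ends pa fe' hy hw.
  have /rcompP[q /rcompP[p xp pq] qy] := mc _ _ _ _ _ ff' hx hy.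
  apply/rcompP; exists q; last exact: rstar_cat qy yw.
  by apply/rcompP; exists p => //; apply: rstar_cat ux xp.
by move/compatibleP: ocb; apply; eauto.
Qed.

(** * One sort of items of a composite, against the composite of the reduced factors *)

Section Level.
Variables (IA OA IB OB IA' OA' IB' OB' : finType).
Variables (rA : {set IA * OA}) (mA : {set OA * IA}).
Variables (rB : {set IB * OB}) (mB : {set OB * IB}) (x : {set OB * IA}).
Variables (iA : IA' -> IA) (oA : OA' -> OA) (iB : IB' -> IB) (oB : OB' -> OB).
Let r := rblock rA set0 rB.
Let m := rblock mA x mB.
Let rA' := pull iA oA (traj rA mA).
Let rB' := pull iB oB (traj rB mB).
Let x' := pull oB iA x.
Let r' := rblock rA' set0 rB'.
Let m' := rblock set0 x' set0 : {set (OA' + OB') * (IA' + IB')}.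

Definition summap (X X' Y Y' : Type) (f : X' -> X) (g : Y' -> Y) (z : X' + Y') : X + Y :=
  match z with inl u => inl (f u) | inr u => inr (g u) end.

Definition sumpred (X Y : Type) (P : pred X) (Q : pred Y) : pred (X + Y) :=
  fun z => match z with inl u => P u | inr u => Q u end.

Hypothesis onto : forall p q, (p, q) \in x -> exists p' q', p = oB p' /\ q = iA q'.

Lemma trajI'E : trajI r' m' = rblock (rid _) (rcomp x' rB') (rid _).
Proof.
rewrite trajI_block; have [-> _ _ _] := traj_m0 rA'; have [-> _ -> _] := traj_m0 rB'.
by rewrite rcomp1l.
Qed.

Lemma trajO'E : trajO r' m' = rblock (rid _) (rcomp rA' x') (rid _).
Proof.
rewrite trajO_block; have [_ -> -> _] := traj_m0 rA'; have [_ -> _ _] := traj_m0 rB'.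
by rewrite rcomp1r.
Qed.

(** A mixed trajectory crosses [x] exactly once, and [onto] puts both entries of the crossing into
    the reduced parts, where the two halves become single steps of [rB'] and [rA']. *)
Lemma pull_traj_block :
  pull (summap iA iB) (summap oA oB) (traj r m) = traj r' m'.
Proof.
rewrite !traj_block; have [_ _ -> _] := traj_m0 rA'; have [_ _ -> _] := traj_m0 rB'.
apply/setP=> -[[a|a] [b|b]]; rewrite in_pull !in_rblock ?in_pull //.
apply/rcompP/rcompP => -[q /rcompP[p]].
  move=> ap pq qb; have [p' [q' [pE qE]]] := onto pq; subst p q.
  exists q'; last by rewrite in_pull.
  by apply/rcompP; exists p'; rewrite in_pull.
rewrite !in_pull => ap pq qb; exists (iA q) => //.
by apply/rcompP; exists (oB p).
Qed.

(** A trajectory starting at an embedded input is cut just after its crossing, if it has one: the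
    first part is visible in the reduced composite, the rest stays inside one factor. On vertices
    this is the hypothesis [factor] of the two-stage reduction. *)
Lemma factorI z w : (summap iA iB z, w) \in trajI r m <->
  exists2 y, (z, y) \in trajI r' m' &
    (summap iA iB y, w) \in rblock (trajI rA mA) set0 (trajI rB mB).
Proof.
rewrite trajI'E trajI_block; case: z w => [z|z] [w|w]; rewrite in_rblock.
- split=> [h|[[y|y]]]; rewrite ?in_rblock //; last by rewrite in_rid => /eqP ->.
  by exists (inl z); rewrite in_rblock ?in_rid.
- by split=> // -[[y|y]]; rewrite !in_rblock.
- split=> [/rcompP[q /rcompP[p zp pq] qw]|].
    have [p' [q' [pE qE]]] := onto pq; subst p q.
    exists (inl q'); rewrite in_rblock //; apply/rcompP; exists p'; by rewrite in_pull.
  move=> [[y|y]]; rewrite !in_rblock ?in_set0 // => /rcompP[p]; rewrite !in_pull => zp py yw.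
  by apply/rcompP; exists (iA y) => //; apply/rcompP; exists (oB p).
split=> [h|[[y|y]]]; rewrite ?in_rblock //; last by rewrite in_rid => /eqP ->.
by exists (inr z); rewrite in_rblock ?in_rid.
Qed.

Lemma factorO z w : (summap oA oB z, w) \in rconv (trajO r m) <->
  exists2 y, (z, y) \in rconv (trajO r' m') &
    (summap oA oB y, w) \in rblock (rconv (trajO rA mA)) set0 (rconv (trajO rB mB)).
Proof.
rewrite trajO'E trajO_block in_rconv; case: z w => [z|z] [w|w]; rewrite in_rblock.
- split=> [h|[[y|y]]]; rewrite ?in_rconv ?in_rblock ?in_rconv ?in_set0 //.
    by exists (inl z); rewrite ?in_rconv in_rblock ?in_rid ?in_rconv.
  by rewrite in_rid => /eqP ->.
- split=> [/rcompP[q /rcompP[p zp pq] qw]|].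
    have [p' [q' [pE qE]]] := onto pq; subst p q.
    exists (inr p'); rewrite ?in_rconv in_rblock ?in_rconv //.
    by apply/rcompP; exists q'; rewrite in_pull.
  move=> [[y|y]]; rewrite in_rconv !in_rblock // in_rconv => /rcompP[p].
  rewrite !in_pull => zp py yw.
  by apply/rcompP; exists (iA p) => //; apply/rcompP; exists (oB y).
- by split=> // -[[y|y]]; rewrite in_rconv !in_rblock ?in_set0.
split=> [h|[[y|y]]]; rewrite ?in_rconv ?in_rblock ?in_rconv ?in_set0 //.
  by exists (inr z); rewrite ?in_rconv in_rblock ?in_rid ?in_rconv.
by rewrite in_rid => /eqP ->.
Qed.

Lemma freeI_sub v : v \notin rim m ->
  sumpred (fun a => a \notin rim mA) (fun b => b \notin rim mB) v.
Proof. by case: v => v; rewrite ?rim_rblock_l ?rim_rblock_r ?negb_or //= => /andP[]. Qed.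

Lemma freeO_sub v : v \notin rdom m ->
  sumpred (fun a => a \notin rdom mA) (fun b => b \notin rdom mB) v.
Proof. by case: v => v; rewrite ?rdom_rblock_l ?rdom_rblock_r ?negb_or //= => /andP[]. Qed.

(** An item free in its factor but consumed in the composite is an entry of [x], hence embedded by
    [onto]. On edges this is the hypothesis [matched] of [no_dangling_comp]. *)
Lemma matchedI v : sumpred (fun a => a \notin rim mA) (fun b => b \notin rim mB) v ->
  ~~ (v \notin rim m) -> exists z, summap iA iB z = v.
Proof.
case: v => v /= /negPf hv; rewrite ?rim_rblock_l ?rim_rblock_r hv //= negbK.
by move=> /rimP[p /onto[p' [q' [_ ->]]]]; exists (inl q').
Qed.

Lemma matchedO v : sumpred (fun a => a \notin rdom mA) (fun b => b \notin rdom mB) v ->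
  ~~ (v \notin rdom m) -> exists z, summap oA oB z = v.
Proof.
case: v => v /= /negPf hv; rewrite ?rdom_rblock_l ?rdom_rblock_r hv ?orbF //= negbK.
by move=> /rdomP[p /onto[p' [q' [-> _]]]]; exists (inr p').
Qed.

Hypothesis iA_free : forall a, iA a \notin rim mA.
Hypothesis iB_free : forall a, iB a \notin rim mB.
Hypothesis oA_free : forall a, oA a \notin rdom mA.
Hypothesis oB_free : forall a, oB a \notin rdom mB.

Lemma freeI_pull z : (summap iA iB z \notin rim m) = (z \notin rim m').
Proof.
have n0 (A B : finType) (b : B) : (b \in rim (set0 : {set A * B})) = false.
  by apply/rimP => -[a]; rewrite in_set0.
case: z => z; rewrite /= ?rim_rblock_l ?rim_rblock_r n0 ?iB_free // (negPf (iA_free _)) /=.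
congr negb; apply/rimP/rimP => -[p h]; last by exists (oB p); rewrite in_pull in h.
by have [p' [q' [pE _]]] := onto h; exists p'; rewrite in_pull -pE.
Qed.

Lemma freeO_pull z : (summap oA oB z \notin rdom m) = (z \notin rdom m').
Proof.
have n0 (A B : finType) (a : A) : (a \in rdom (set0 : {set A * B})) = false.
  by apply/rdomP => -[b]; rewrite in_set0.
case: z => z; rewrite /= ?rdom_rblock_l ?rdom_rblock_r n0 ?oA_free // (negPf (oB_free _)) ?orbF.
congr negb; apply/rdomP/rdomP => -[p h]; last by exists (iA p); rewrite in_pull in h.
by have [p' [q' [_ qE]]] := onto h; exists q'; rewrite in_pull -qE.
Qed.

End Level.

Section GsumEnds.
Variables (G H : pregraph) (UV : pred (vert G)) (WV : pred (vert H)).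
Variables (S : {set vert G * vert G}) (T : {set vert H * vert H}).

Lemma has_ends_inl (e : edge G) :
  has_ends (G := gsum G H) (sumpred UV WV) (rblock S set0 T) (inl e) <->
  has_ends UV S e.
Proof.
split=> h c; have [v [u [eu hv vu]]] := h c.
  move: eu; rewrite ep_inl; case eu: (ep c e) => [w|] //= [wu]; subst u.
  by case: v hv vu => v hv; rewrite in_rblock ?in_set0 // => vu; exists v, w.
by exists (inl v), (inl u); split; rewrite ?in_rblock ?ep_inl ?eu.
Qed.

Lemma has_ends_inr (e : edge H) :
  has_ends (G := gsum G H) (sumpred UV WV) (rblock S set0 T) (inr e) <->
  has_ends WV T e.
Proof.
split=> h c; have [v [u [eu hv vu]]] := h c.
  move: eu; rewrite ep_inr; case eu: (ep c e) => [w|] //= [wu]; subst u.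
  by case: v hv vu => v hv; rewrite in_rblock ?in_set0 // => vu; exists v, w.
by exists (inr v), (inr u); split; rewrite ?in_rblock ?ep_inr ?eu.
Qed.

Lemma no_dangling_gsum (UE : pred (edge G)) (WE : pred (edge H)) :
  no_dangling (G := gsum G H) (sumpred UV WV) (sumpred UE WE) (rblock S set0 T) <->
  no_dangling UV UE S /\ no_dangling WV WE T.
Proof.
split=> [h|[hG hH] [e|e] he].
- by split=> e he; [apply/has_ends_inl/h|apply/has_ends_inr/h].
- exact/has_ends_inl/hG.
exact/has_ends_inr/hH.
Qed.

End GsumEnds.

(** First stage of the reduction of a composite: the factors are reduced side by side, as if nothing
    were matched between them; hence the zero block. *)
Lemma bside_gsum del G H G' H' UV UE S WV WE T jV jE kV kE :
  @bside del G G' UV UE S jV jE -> @bside del H H' WV WE T kV kE ->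
  @bside del (gsum G H) (gsum G' H') (sumpred UV WV) (sumpred UE WE)
    (rblock S set0 T) (summap jV kV) (summap jE kE).
Proof.
move=> J L.
split.
- by move=> [u|u] [v|v] //= [] e; congr (_ _); [apply: (bs_injV J)|apply: (bs_injV L)].
- by move=> [u|u] [v|v] //= [] e; congr (_ _); [apply: (bs_injE J)|apply: (bs_injE L)].
- move=> [v|v] /=.
    rewrite -(bs_imV J); split=> [[[x|x] //= [<-]]|[x <-]]; first by exists x.
    by exists (inl x).
  rewrite -(bs_imV L); split=> [[[x|x] //= [<-]]|[x <-]]; first by exists x.
  by exists (inr x).
- move=> [v|v]; rewrite ?has_ends_inl ?has_ends_inr /=.
    rewrite -(bs_imE J); split=> [[[x|x] //= [<-]]|[x <-]]; first by exists x.
    by exists (inl x).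
  rewrite -(bs_imE L); split=> [[[x|x] //= [<-]]|[x <-]]; first by exists x.
  by exists (inr x).
move=> c [x|x] [v|v] /=; rewrite ?ep_inl ?ep_inr.
- have := bs_ep J c x v; case: (ep c x) => [w|] h; split=> /=.
  + move=> [wv]; have [|u eu vu] := h.1; first by rewrite wv.
    by exists (inl u); rewrite ?in_rblock ?eu.
  + case: (ep c (jE x)) h => [u|] h [y] //= [<-]; rewrite in_rblock => vu.
    by have [->] := h.2 (ex_intro2 _ _ u erefl vu).
  + by [].
  case: (ep c (jE x)) h => [u|] h [y] //= [<-]; rewrite in_rblock => vu.
  by have := h.2 (ex_intro2 _ _ u erefl vu).
- split=> [|[u]]; first by case: (ep _ _).
  by case: (ep _ _) => [w|] //= [<-]; rewrite in_rblock in_set0.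
- split=> [|[u]]; first by case: (ep _ _).
  by case: (ep _ _) => [w|] //= [<-]; rewrite in_rblock.
have := bs_ep L c x v; case: (ep c x) => [w|] h; split=> /=.
+ move=> [wv]; have [|u eu vu] := h.1; first by rewrite wv.
  by exists (inr u); rewrite ?in_rblock ?eu.
+ case: (ep c (kE x)) h => [u|] h [y] //= [<-]; rewrite in_rblock => vu.
  by have [->] := h.2 (ex_intro2 _ _ u erefl vu).
+ by [].
case: (ep c (kE x)) h => [u|] h [y] //= [<-]; rewrite in_rblock => vu.
by have := h.2 (ex_intro2 _ _ u erefl vu).
Qed.

(** * Matchings of two diagrams and of their full reductions *)

Definition push (A B A' B' : finType) (f : A' -> A) (g : B' -> B)
    (R : {set A' * B'}) : {set A * B} := [set (f p.1, g p.2) | p in R].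

Section Push.
Variables (A B A' B' : finType) (f : A' -> A) (g : B' -> B).

Lemma in_push (R : {set A' * B'}) x y : injective f -> injective g ->
  ((f x, g y) \in push f g R) = ((x, y) \in R).
Proof.
move=> fI gI; apply/imsetP/idP => [[[x' y'] h [/fI -> /gI ->]]|h] //.
by exists (x, y).
Qed.

Lemma pushP (R : {set A' * B'}) p q : (p, q) \in push f g R ->
  exists x y, [/\ p = f x, q = g y & (x, y) \in R].
Proof. by case/imsetP=> -[x y] h [-> ->]; exists x, y. Qed.

Lemma pushK (R : {set A' * B'}) : injective f -> injective g ->
  pull f g (push f g R) = R.
Proof. by move=> fI gI; apply/setP=> -[x y]; rewrite in_pull in_push. Qed.

Lemma pullK (R : {set A * B}) : injective f -> injective g ->
  (forall p q, (p, q) \in R -> exists x y, p = f x /\ q = g y) ->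
  push f g (pull f g R) = R.
Proof.
move=> fI gI onto; apply/setP=> -[p q]; apply/idP/idP.
  by case/pushP=> x [y [-> ->]]; rewrite in_pull.
by move=> h; have [x [y [pE qE]]] := onto _ _ h; subst; rewrite in_push // in_pull.
Qed.

Lemma one_to_one_push (R : {set A' * B'}) : injective f -> injective g ->
  one_to_one R -> one_to_one (push f g R).
Proof.
move=> fI gI /one_to_oneP[h k]; apply/one_to_oneP; split.
  move=> a b b' /pushP[x [y [-> -> xy]]] /pushP[x' [y' [/fI <- -> xy']]].
  by rewrite (h _ _ _ xy xy').
move=> a a' b /pushP[x [y [-> -> xy]]] /pushP[x' [y' [-> /gI <- xy']]].
by rewrite (k _ _ _ xy xy').
Qed.

End Push.

(** Without matches inside the factors, [trajI] and [trajO] are identities, so the third clause of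
    [matching] becomes plain compatibility of [m]. *)
Lemma matching_irr A B (m : grel (out B) (inp A)) :
  mm A = grel0 _ _ -> mm B = grel0 _ _ ->
  matching m <-> [/\ one_to_one m.1, one_to_one m.2 &
    forall f f' c v v', (f, f') \in m.2 -> ep c f = Some v -> ep c f' = Some v' ->
      (v, v') \in m.1].
Proof.
rewrite /matching => -> -> /=.
have [-> _ _ _] := traj_m0 (rr A).1; have [_ -> _ _] := traj_m0 (rr B).1.
rewrite rcomp1r rcomp1l; split=> [[/one_to_one_rblock[]]|[m1 m2 h]].
  by move=> _ m1 _ _ /one_to_one_rblock[_ m2 _ _] h.
have o0 (X Y : finType) : one_to_one (set0 : {set X * Y}) by move=> p q; rewrite in_set0.
have n0 (X Y : finType) (y : Y) : y \notin rim (set0 : {set X * Y}).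
  by apply/rimP => -[x]; rewrite in_set0.
have n0' (X Y : finType) (x : X) : x \notin rdom (set0 : {set X * Y}).
  by apply/rdomP => -[y]; rewrite in_set0.
by split=> //; apply/one_to_one_rblock; split.
Qed.

Section ReductComp.
Variables (A B A' B' : diagram).
Variables (iVA : vert (inp A') -> vert (inp A)) (iEA : edge (inp A') -> edge (inp A)).
Variables (oVA : vert (out A') -> vert (out A)) (oEA : edge (out A') -> edge (out A)).
Variables (iVB : vert (inp B') -> vert (inp B)) (iEB : edge (inp B') -> edge (inp B)).
Variables (oVB : vert (out B') -> vert (out B)) (oEB : edge (out B') -> edge (out B)).
Hypothesis RA : reduction true true iVA iEA oVA oEA.
Hypothesis RB : reduction true true iVB iEB oVB oEB.

Definition restrict (m : grel (out B) (inp A)) : grel (out B') (inp A') :=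
  (pull oVB iVA m.1, pull oEB iEA m.2).

Definition extend (m : grel (out B') (inp A')) : grel (out B) (inp A) :=
  (push oVB iVA m.1, push oEB iEA m.2).

Let IA := red_inp RA. Let OA := red_out RA.
Let IB := red_inp RB. Let OB := red_out RB.

Lemma extendK m : restrict (extend m) = m.
Proof.
case: m => m1 m2; congr pair; apply: pushK;
  by [apply: bs_injV OB|apply: bs_injV IA|apply: bs_injE OB|apply: bs_injE IA].
Qed.

Hypothesis pA : prerule A.
Hypothesis pB : prerule B.

(** Unmatched items lie in the full reduction unless they are dangling edges. At each end of a
    matched edge, the third clause of [matching] yields a pair of vertices in [m.1] on the
    trajectory between the ends; these vertices are unmatched inside the factors, so the edge
    dangles on neither side. *)
Lemma matching_onto m : matching m ->
  (forall p q, (p, q) \in m.1 -> exists x y, p = oVB x /\ q = iVA y) /\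
  (forall p q, (p, q) \in m.2 -> exists x y, p = oEB x /\ q = iEA y).
Proof.
move=> [/one_to_one_rblock[_ _ _ d1] /one_to_one_rblock[_ _ _ d2] mc].
split=> p q pq.
  have [hp hq] := d1 _ _ pq.
  have /(bs_imV OB)[x xp] := hp; have /(bs_imV IA)[y yq] := hq.
  by exists x, y.
have [hp hq] := d2 _ _ pq.
have ends c : exists u v w z, [/\ ep c p = Some u, ep c q = Some v,
    (u, w) \in trajO (rr B).1 (mm B).1, (w, z) \in m.1
  & (z, v) \in trajI (rr A).1 (mm A).1].
  have [_ _ _ gIA _] := pA; have [_ _ _ _ gOB] := pB.
  have [u eu] := (is_graphP _).1 gOB p c; have [v ev] := (is_graphP _).1 gIA q c.
  have /rcompP[z /rcompP[w uw wz] zv] := mc _ _ _ _ _ pq eu ev.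
  by exists u, v, w, z.
have [|x xp] := (bs_imE OB p).2.
  split=> // _ c; have [u [v [w [z [eu ev uw wz zv]]]]] := ends c.
  by exists w, u; rewrite in_rconv; split=> //; have [] := d1 _ _ wz.
have [|y yq] := (bs_imE IA q).2.
  split=> // _ c; have [u [v [w [z [eu ev uw wz zv]]]]] := ends c.
  by exists z, v; split=> //; have [] := d1 _ _ wz.
by exists x, y.
Qed.

Lemma restrictK m : matching m -> extend (restrict m) = m.
Proof.
case: m => m1 m2 /matching_onto[h1 h2]; congr pair; apply: pullK => //;
  by [apply: bs_injV OB|apply: bs_injV IA|apply: bs_injE OB|apply: bs_injE IA].
Qed.

(** The full reductions are graphs, so a matched edge has both ends there. By [bs_ep] each of these
    is linked by a trajectory to the end in the original factor, which gives the outer parts of the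
    required composite. *)
Lemma matching_extend m : matching m -> matching (extend m).
Proof.
have gA : is_graph (inp A') by apply/(bside_graph IA); left.
have gB : is_graph (out B') by apply/(bside_graph OB); left.
have [_ [mA1 mA2] _ _ _] := pA; have [_ [mB1 mB2] _ _ _] := pB.
move=> /(matching_irr _ (red_mm RA) (red_mm RB))[m1 m2 mc]; split.
- apply/one_to_one_rblock; split=> //.
    by apply: one_to_one_push m1; [apply: bs_injV OB|apply: bs_injV IA].
  by move=> _ _ /pushP[x [y [-> -> _]]]; split; [apply: bs_UV OB _|apply: bs_UV IA _].
- apply/one_to_one_rblock; split=> //.
    by apply: one_to_one_push m2; [apply: bs_injE OB|apply: bs_injE IA].
  by move=> _ _ /pushP[x [y [-> -> _]]]; split; [apply: bs_UE OB _|apply: bs_UE IA _].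
move=> _ _ c v v' /pushP[x [y [-> -> xy]]] ev ev'.
have [p ep_x] := (is_graphP _).1 gB x c; have [q ep_y] := (is_graphP _).1 gA y c.
have [u eu pu] := (bs_ep OB _ _ _).1 ep_x; have [w ew qw] := (bs_ep IA _ _ _).1 ep_y.
move: eu ew; rewrite ev ev' => -[uE] [wE]; subst u w; rewrite in_rconv in pu.
apply/rcompP; exists (iVA q) => //; apply/rcompP; exists (oVB p) => //.
rewrite in_push; [exact: mc xy ep_x ep_y|exact: bs_injV OB|exact: bs_injV IA].
Qed.

Lemma matching_restrict m : matching m -> matching (restrict m).
Proof.
move=> mm0; have [onto _] := matching_onto mm0; move: mm0.
move=> [/one_to_one_rblock[_ m1 _ d1] /one_to_one_rblock[_ m2 _ d2] mc].
apply/(matching_irr _ (red_mm RA) (red_mm RB)); split.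
- by apply: one_to_one_pull m1; [apply: bs_injV OB|apply: bs_injV IA].
- by apply: one_to_one_pull m2; [apply: bs_injE OB|apply: bs_injE IA].
move=> f f' c v v'; rewrite in_pull => ff'.
move=> /(bs_ep OB)[u eu vu] /(bs_ep IA)[u' eu' vu'].
have /rcompP[q /rcompP[p up pq] qu'] := mc _ _ _ _ _ ff' eu eu'.
have [x [y [pE qE]]] := onto _ _ pq; subst p q; rewrite in_pull.
(* The crossing pair and the reduced ends are linked to the same [u] and [u']; by [bs_ep] both are
   values of the function [ep], hence equal. *)
suff [-> ->] : v = x /\ v' = y by [].
split.
  apply/Some_inj; rewrite -((bs_ep OB c f v).2 _); last by exists u.
  by apply/(bs_ep OB); exists u; rewrite ?in_rconv.
apply/Some_inj; rewrite -((bs_ep IA c f' v').2 _); last by exists u'.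
by apply/(bs_ep IA); exists u'.
Qed.

Section Matched.
Variable m : grel (out B) (inp A).
Hypothesis hm : matching m.
Let D := dcomp m.
Let D' := dcomp (restrict m).

Let mA0 : mm A' = grel0 _ _ := red_mm RA.
Let mB0 : mm B' = grel0 _ _ := red_mm RB.

Let rE1 : (rr D').1 = rblock (pull iVA oVA (traj (rr A).1 (mm A).1)) set0
                             (pull iVB oVB (traj (rr B).1 (mm B).1)).
Proof. by rewrite /= (red_rV RA) (red_rV RB). Qed.
Let rE2 : (rr D').2 = rblock (pull iEA oEA (traj (rr A).2 (mm A).2)) set0
                             (pull iEB oEB (traj (rr B).2 (mm B).2)).
Proof. by rewrite /= (red_rE RA) (red_rE RB). Qed.
Let mE1 : (mm D').1 = rblock set0 (pull oVB iVA m.1) set0.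
Proof. by rewrite /= mA0 mB0. Qed.
Let mE2 : (mm D').2 = rblock set0 (pull oEB iEA m.2) set0.
Proof. by rewrite /= mA0 mB0. Qed.

Let onto1 := (matching_onto hm).1.
Let onto2 := (matching_onto hm).2.

Let iV := summap iVA iVB. Let iE := summap iEA iEB.
Let oV := summap oVA oVB. Let oE := summap oEA oEB.

Let sideI_A : bside true (G := inp D) (G' := inp D')
  (sumpred (freeIV A) (freeIV B)) (sumpred (freeIE A) (freeIE B))
  (rblock (sideI A) set0 (sideI B)) iV iE := bside_gsum IA IB.

Let sideO_A : bside true (G := out D) (G' := out D')
  (sumpred (freeOV A) (freeOV B)) (sumpred (freeOE A) (freeOE B))
  (rblock (sideO A) set0 (sideO B)) oV oE := bside_gsum OA OB.

Let pullIV v : freeIV D (iV v) = freeIV D' v.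
Proof.
rewrite /freeIV mE1; apply: freeI_pull => //.
  exact: bs_UV IA.
exact: bs_UV IB.
Qed.

Let pullIE e : freeIE D (iE e) = freeIE D' e.
Proof.
rewrite /freeIE mE2; apply: freeI_pull => //.
  exact: bs_UE IA.
exact: bs_UE IB.
Qed.

Let pullOV v : freeOV D (oV v) = freeOV D' v.
Proof.
rewrite /freeOV mE1; apply: freeO_pull => //.
  exact: bs_UV OA.
exact: bs_UV OB.
Qed.

Let pullOE e : freeOE D (oE e) = freeOE D' e.
Proof.
rewrite /freeOE mE2; apply: freeO_pull => //.
  exact: bs_UE OA.
exact: bs_UE OB.
Qed.

Let factI x w : (iV x, w) \in sideI D <->
  exists2 y, (x, y) \in sideI D' & (iV y, w) \in rblock (sideI A) set0 (sideI B).
Proof. by rewrite /sideI rE1 mE1; apply: factorI. Qed.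

Let factO x w : (oV x, w) \in sideO D <->
  exists2 y, (x, y) \in sideO D' & (oV y, w) \in rblock (sideO A) set0 (sideO B).
Proof. by rewrite /sideO rE1 mE1; apply: factorO. Qed.

(** Second stage: [C] embeds into [D'], and [D'] embeds into [D] by the side-by-side reduction, so
    [bside_comp] applies to the inputs and to the outputs. *)
Lemma reduct_dcomp C : reduct true true D' C -> reduct true true D C.
Proof.
move=> [iV' [iE' [oV' [oE' [jI jO hV hE m0]]]]].
exists (iV \o iV'), (iE \o iE'), (oV \o oV'), (oE \o oE'); split=> //.
- by apply: (bside_comp sideI_A _ _ pullIV pullIE factI jI) => v; apply: freeI_sub.
- by apply: (bside_comp sideO_A _ _ pullOV pullOE factO jO) => v; apply: freeO_sub.
- rewrite hV rE1 mE1 -pull_traj_block //.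
  by apply/setP=> -[x y]; rewrite !in_pull.
rewrite hE rE2 mE2 -pull_traj_block //.
by apply/setP=> -[x y]; rewrite !in_pull.
Qed.

(** From left to right, the edges consumed by [m] need an argument of their own: by [matchedI] they
    come from the full reductions, so they do not dangle in their factor. *)
Lemma no_dangling_inp : no_dangling (freeIV D) (freeIE D) (sideI D) <->
  [/\ no_dangling (freeIV A) (freeIE A) (sideI A),
      no_dangling (freeIV B) (freeIE B) (sideI B)
    & no_dangling (freeIV D') (freeIE D') (sideI D')].
Proof.
rewrite (no_dangling_comp sideI_A _ _ pullIV pullIE factI).
- by rewrite no_dangling_gsum; split=> [[[]]|[]].
- by move=> v; apply: freeI_sub.
- by move=> v; apply: freeI_sub.
by move=> e he hd; have [x] := matchedI iEB onto2 he hd; exists x.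
Qed.

Lemma no_dangling_out : no_dangling (freeOV D) (freeOE D) (sideO D) <->
  [/\ no_dangling (freeOV A) (freeOE A) (sideO A),
      no_dangling (freeOV B) (freeOE B) (sideO B)
    & no_dangling (freeOV D') (freeOE D') (sideO D')].
Proof.
rewrite (no_dangling_comp sideO_A _ _ pullOV pullOE factO).
- by rewrite no_dangling_gsum; split=> [[[]]|[]].
- by move=> v; apply: freeO_sub.
- by move=> v; apply: freeO_sub.
by move=> e he hd; have [x] := matchedO oEA onto2 he hd; exists x.
Qed.

End Matched.
End ReductComp.
(** * Numberings and invariance under isomorphism *)

Section Numbering.

(** A splitting of the image pulls back along [j] to a splitting of [X]. *)
Lemma connected_on_imset (d d' : diagram) (j : item d -> item d') (X : {set item d}) :
  injective j -> (forall x y, linked (j x) (j y) = linked x y) ->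
  connected_on X -> connected_on (j @: X).
Proof.
move=> jI jL [X0 con]; split=> [|[Y [Z [Y0 Z0 XE YZ sep]]]].
  by move=> /eqP; rewrite imset_eq0 => /eqP.
have ne W : W <> set0 -> W \subset j @: X -> j @^-1: W <> set0.
  move=> /eqP/set0Pn[w wW] /subsetP/(_ _ wW)/imsetP[x _ wE] /setP/(_ x).
  by rewrite !inE -wE wW.
apply: con; exists (j @^-1: Y), (j @^-1: Z); split.
- by apply: ne Y0 _; rewrite XE subsetUl.
- by apply: ne Z0 _; rewrite XE subsetUr.
- by apply/setP=> x; rewrite -(mem_imset _ _ jI) XE !inE.
- apply/pred0P => x /=; rewrite !inE; apply/negP => /andP[xY xZ].
  by have /pred0P/(_ (j x)) := YZ; rewrite /= xY xZ.
by move=> y z; rewrite !inE => yY zZ; rewrite -!jL; apply: sep.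
Qed.

Lemma numbered_iso d d' : diagram_iso d d' -> numbered d -> numbered d'.
Proof.
move=> iso [n [k [kL kC kV kE]]].
have [f [g [/graph_isoP[[f1 F1 F1'] [f2 F2 F2'] fE] gi [r1 r2] [m1 m2]]]] := iso.
have /graph_isoP[[g1 G1 G1'] [g2 G2 G2'] gE] := gi.
have [[_ _ fs ft] [_ _ gs gt]] : graph_iso f /\ graph_iso g.
  by split; apply/graph_isoP; split=> //; [exists f1|exists f2|exists g1|exists g2].
pose j : item d -> item d' := summap (summap f.1 f.2) (summap g.1 g.2).
pose j' : item d' -> item d := summap (summap f1 f2) (summap g1 g2).
have jK : cancel j j' by move=> [[x|x]|[x|x]]; rewrite /j /j' /= ?F1 ?F2 ?G1 ?G2.
have jK' : cancel j' j by move=> [[x|x]|[x|x]]; rewrite /j /j' /= ?F1' ?F2' ?G1' ?G2'.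
have eqs (V V' : eqType) (h : V -> V') (o : option V) v : injective h ->
    (omap h o == Some (h v)) = (o == Some v).
  move=> hI; case: o => [u|] //=; apply/eqP/eqP => [[/hI ->]|[->]] //.
have jL x y : linked (j x) (j y) = linked x y.
  case: x y => [[x|x]|[x|x]] [[y|y]|[y|y]] //=.
  - by rewrite fs ft !eqs //; apply: can_inj F1.
  - by rewrite gs gt !eqs //; apply: can_inj G1.
exists n, (k \o j'); split=> [x y|i|v v'|e e'].
- by rewrite -{1}[x]jK' -{1}[y]jK' jL => /kL.
- have -> : [set x | (k \o j') x == i] = j @: [set x | k x == i].
    by apply/setP=> x; rewrite -[x]jK' mem_imset ?inE /= ?jK' //; apply: can_inj jK.
  by apply: connected_on_imset (kC i) => //; apply: can_inj jK.
- by rewrite -{1}[v']G1' -{1}[v]F1' m1 => /kV.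
by rewrite -{1}[e']G2' -{1}[e]F2' m2 => /kE.
Qed.

Definition item_dcomp a b (m : grel (out b) (inp a)) (x : item a + item b) :
    item (dcomp m) :=
  match x with
  | inl (inl (inl v)) => inl (inl (inl v))
  | inl (inl (inr e)) => inl (inr (inl e))
  | inl (inr (inl v)) => inr (inl (inl v))
  | inl (inr (inr e)) => inr (inr (inl e))
  | inr (inl (inl v)) => inl (inl (inr v))
  | inr (inl (inr e)) => inl (inr (inr e))
  | inr (inr (inl v)) => inr (inl (inr v))
  | inr (inr (inr e)) => inr (inr (inr e))
  end.

Definition dcomp_item a b (m : grel (out b) (inp a)) (x : item (dcomp m)) :
    item a + item b :=
  match x with
  | inl (inl (inl v)) => inl (inl (inl v))
  | inl (inr (inl e)) => inl (inl (inr e))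
  | inr (inl (inl v)) => inl (inr (inl v))
  | inr (inr (inl e)) => inl (inr (inr e))
  | inl (inl (inr v)) => inr (inl (inl v))
  | inl (inr (inr e)) => inr (inl (inr e))
  | inr (inl (inr v)) => inr (inr (inl v))
  | inr (inr (inr e)) => inr (inr (inr e))
  end.

(* The constituents of [a] are numbered before those of [b], as [m] matches
   outputs of [b] with inputs of [a]. *)
Lemma numbered_dcomp a b (m : grel (out b) (inp a)) :
  numbered a -> numbered b -> numbered (dcomp m).
Proof.
move=> [n [k [kL kC kV kE]]] [p [l [lL lC lV lE]]].
have K : cancel (@item_dcomp a b m) (@dcomp_item a b m).
  by move=> [[[x|x]|[x|x]]|[[x|x]|[x|x]]].
have J := can_inj K.
have K' : cancel (@dcomp_item a b m) (@item_dcomp a b m).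
  by move=> [[[x|x]|[x|x]]|[[x|x]|[x|x]]].
have L x y : linked (item_dcomp m x) (item_dcomp m y) =
    match x, y with
    | inl x, inl y => linked x y
    | inr x, inr y => linked x y
    | _, _ => false end.
  case: x y => [[[x|x]|[x|x]]|[[x|x]|[x|x]]] [[[y|y]|[y|y]]|[[y|y]|[y|y]]] //=;
    rewrite ?in_rblock ?in_set0 //; by case: (src x) (tgt x) => [u|] [w|].
pose q (x : item (dcomp m)) : 'I_(n + p) := unsplit (match dcomp_item x with
  | inl y => inl (k y) | inr y => inr (l y) end).
exists (n + p)%N, q.
split=> [x y|i|v v'|e e'].
- rewrite -{1}[x]K' -{1}[y]K' L /q.
  by case: (dcomp_item x) (dcomp_item y) => [u|u] [w|w] // => [/kL ->|/lL ->].
- case: (split_ordP i) => i0 ->.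
    have -> : [set x | q x == lshift p i0] = (item_dcomp m \o inl) @: [set x | k x == i0].
      apply/setP=> x; rewrite inE -[x]K' /q K; apply/eqP/imsetP.
        case: (dcomp_item x) => [u|u] /= /(congr1 (@split n p)); last first.
          by rewrite -/(unsplit (inr _)) -/(unsplit (inl _)) !unsplitK.
        rewrite -/(unsplit (inl (k u))) -/(unsplit (inl i0)) !unsplitK => -[e].
        by exists u; rewrite // inE e.
      by move=> [u + e]; rewrite (J _ _ e) inE => /eqP ->.
    apply: connected_on_imset (kC i0) => [x y /J []|x y]; [by []|].
    exact: L.
  have -> : [set x | q x == rshift n i0] = (item_dcomp m \o inr) @: [set x | l x == i0].
    apply/setP=> x; rewrite inE -[x]K' /q K; apply/eqP/imsetP.
      case: (dcomp_item x) => [u|u] /= /(congr1 (@split n p)).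
        by rewrite -/(unsplit (inl _)) -/(unsplit (inr _)) !unsplitK.
      rewrite -/(unsplit (inr (l u))) -/(unsplit (inr i0)) !unsplitK => -[e].
      by exists u; rewrite // inE e.
    by move=> [u + e]; rewrite (J _ _ e) inE => /eqP ->.
  apply: connected_on_imset (lC i0) => [x y /J []|x y]; [by []|].
  exact: L.
- case: v v' => [v|v] [v'|v']; rewrite in_rblock // /q /=.
  + exact: kV.
  + by move=> _; apply: leq_trans (ltn_ord _) (leq_addr _ _).
  by rewrite ltn_add2l; apply: lV.
case: e e' => [v|v] [v'|v']; rewrite in_rblock // /q /=.
+ exact: kE.
+ by move=> _; apply: leq_trans (ltn_ord _) (leq_addr _ _).
by rewrite ltn_add2l; apply: lE.
Qed.

End Numbering.

Lemma is_graph_iso G H f : @graph_iso G H f -> is_graph H -> is_graph G.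
Proof.
move=> [_ _ s t] gH e; have := gH (f.2 e); rewrite /dangling s t.
by case: (src e); case: (tgt e).
Qed.

Lemma compatible_iso G H G' H' f g (R : grel G H) (R' : grel G' H') :
  graph_iso f -> graph_iso g -> rel_iso f g R R' -> compatible R' -> compatible R.
Proof.
move=> /graph_isoP[_ _ fE] /graph_isoP[_ _ gE] [h1 h2] /compatibleP c.
apply/compatibleP => e e' b v v' ee' hv hv'; rewrite -h1.
by apply: (c (f.2 e) (g.2 e') b); rewrite ?h2 // ?fE ?gE ?hv ?hv'.
Qed.

Lemma prerule_iso d d' : diagram_iso d d' -> prerule d' -> prerule d.
Proof.
move=> [f [g [fI gI rI mI]]] [[[r1 r2] rc] [m1 m2] oc gi go].
have [bf1 bf2 _ _] := fI; have [bg1 bg2 _ _] := gI.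
have rE := (rel_iso_pull _ _ _ _).1 rI; have mE := (rel_iso_pull _ _ _ _).1 mI.
split.
- by split; [split; rewrite rE /=; apply: one_to_one_pull => //; apply: bij_inj
            |apply: compatible_iso rI rc].
- by split; rewrite mE /=; apply: one_to_one_pull => //; apply: bij_inj.
- apply: compatible_iso gI fI _ oc; apply/rel_iso_pull.
  rewrite -[omega d]/(trajOI (rr d).1 (mm d).1, trajOI (rr d).2 (mm d).2) rE mE /=.
  by rewrite -!pull_trajOI.
- exact: is_graph_iso fI gi.
exact: is_graph_iso gI go.
Qed.

Lemma is_rule_diagram_iso d d' :
  diagram_iso d d' -> is_rule_diagram d -> is_rule_diagram d'.
Proof.
move=> iso /is_rule_diagramE[p n]; apply/is_rule_diagramE; split.
  exact: prerule_iso (diagram_iso_sym iso) p.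
exact: numbered_iso n.
Qed.

Lemma is_irr_iso d d' : diagram_iso d d' -> is_irr d -> is_irr d'.
Proof.
move=> iso [rd m0]; split; first exact: is_rule_diagram_iso rd.
have [f [g [_ _ _ /rel_iso_pull]]] := diagram_iso_sym iso; rewrite m0 => ->.
by congr pair; apply/setP=> -[x y]; rewrite in_pull !in_set0.
Qed.

Lemma is_rule_diagram_dcomp a b (m : grel (out b) (inp a)) :
  is_rule_diagram a -> is_rule_diagram b ->
  is_rule_diagram (dcomp m) <-> matching m.
Proof.
move=> /is_rule_diagramE[pa na] /is_rule_diagramE[pb nb].
split=> [/is_rule_diagramE[/prerule_dcomp[] //]|hm].
by apply/is_rule_diagramE; split; [apply/prerule_dcomp|apply: numbered_dcomp].
Qed.
(** * The algebras *)

Section LinearExtension.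
Variable K : fieldType.

Section LinearFacts.
Variables (U V : lmodType K) (f : U -> V).
Hypothesis fL : linear f.

Lemma lin0 : f 0 = 0.
Proof. by have := fL (-1) 0 0; rewrite scaleN1r oppr0 addr0 scaleN1r addNr. Qed.

Lemma linD x y : f (x + y) = f x + f y.
Proof. by have := fL 1 x y; rewrite !scale1r. Qed.

Lemma linZ c x : f (c *: x) = c *: f x.
Proof. by have := fL c x 0; rewrite lin0 !addr0. Qed.

Lemma lin_sum (I : Type) (r : seq I) (P : pred I) (F : I -> U) :
  f (\sum_(i <- r | P i) F i) = \sum_(i <- r | P i) f (F i).
Proof. exact: (big_morph f linD lin0). Qed.

End LinearFacts.

Lemma linear_comp (U V W : lmodType K) (g : V -> W) (f : U -> V) :
  linear g -> linear f -> linear (g \o f).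
Proof. by move=> gL fL c x y /=; rewrite fL gL. Qed.

Variables (B : choiceType) (V : lmodType K).

Lemma lin_extE (f : B -> V) (x : {malg K[B]}) (A : {fset B}) : (msupp x `<=` A)%fset ->
  lin_ext f x = \sum_(b <- A) x@_b *: f b.
Proof. by move=> le; apply: big_fset_incl le _ => b _ /mcoeff_outdom ->; rewrite scale0r. Qed.

Lemma lin_ext_linear (f : B -> V) : linear (lin_ext f).
Proof.
move=> c x y; pose A := (msupp x `|` msupp y)%fset.
have leA : (msupp (c *: x + y) `<=` A)%fset.
  apply: fsubset_trans (msuppD_le _ _) _; apply: fsetSU; exact: msuppZ_le.
rewrite (lin_extE _ leA) (lin_extE _ (fsubsetUl _ (msupp y))).
rewrite (lin_extE _ (fsubsetUr (msupp x) _)) scaler_sumr -big_split /=.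
by apply: eq_bigr => b _; rewrite mcoeffD mcoeffZ scalerDl scalerA.
Qed.

Lemma lin_extU (f : B -> V) b : lin_ext f << b >> = f b.
Proof.
by rewrite (lin_extE _ msuppU_le) big_seq_fset1 mcoeffUU scale1r.
Qed.

Lemma lin_ext_fun_linear (U : lmodType K) (F : B -> U -> V) (x : {malg K[B]}) :
  (forall b, linear (F b)) -> linear (fun y => lin_ext (F^~ y) x).
Proof.
move=> FL c y z; rewrite /lin_ext scaler_sumr -big_split /=.
by apply: eq_bigr => b _; rewrite FL scalerDr !scalerA mulrC.
Qed.

Lemma eq_linear (f g : {malg K[B]} -> V) : linear f -> linear g ->
  (forall b, f << b >> = g << b >>) -> f =1 g.
Proof.
move=> fL gL fg x; rewrite (monalgE x) (lin_sum fL) (lin_sum gL).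
apply: eq_bigr => b _; have -> : << x@_b *g b >> = x@_b *: << b >> :> {malg K[B]}.
  by apply/malgP=> b'; rewrite mcoeffZ !mcoeffU mulrnAr mulr1.
by rewrite (linZ fL) (linZ gL) fg.
Qed.

End LinearExtension.

Section Basis.
Variables (K : fieldType) (P : diagram -> Prop).

(** Extending basis vectors by zero to all raw diagrams lets the sums over matchings range over
    every relation, so that reindexing them involves no side condition. *)
Definition basis (d : diagram) : {malg K[classes P]} :=
  match pselect (P d) with left h => << mkclass h >> | right _ => 0 end.

Lemma mkclass_eq d d' (h : P d) (h' : P d') : diagram_iso d d' -> mkclass h = mkclass h'.
Proof. by move=> iso; apply/val_inj/classP. Qed.

Lemma basisE d (h : P d) : basis d = << mkclass h >>.
Proof.
rewrite /basis; case: pselect => h'; last by case: (h' h).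
by rewrite (mkclass_eq h' h (diagram_iso_refl d)).
Qed.

Lemma basis0 d : ~ P d -> basis d = 0.
Proof. by rewrite /basis; case: pselect. Qed.

Lemma rep_iso d (h : P d) : diagram_iso (rep (mkclass h)) d.
Proof. by apply/classP; rewrite class_rep. Qed.

Lemma basis_rep x : basis (rep x) = << x >>.
Proof.
rewrite (basisE (repP x)); congr << _ >>; apply: val_inj.
exact: class_rep.
Qed.

Lemma basis_iso d d' : (P d <-> P d') -> diagram_iso d d' -> basis d = basis d'.
Proof.
move=> PP iso; case: (pselect (P d)) => h.
  by rewrite (basisE h) (basisE (PP.1 h)) (mkclass_eq h (PP.1 h) iso).
by rewrite !basis0 // => /PP.
Qed.

End Basis.

Section RuleAlgebraProof.
Variable K : fieldType.

Local Notation bD := (@basis K is_rule_diagram).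
Local Notation bI := (@basis K is_irr).

Lemma bD_iso d d' : diagram_iso d d' -> bD d = bD d'.
Proof.
move=> iso; apply: basis_iso (iso); split; apply: is_rule_diagram_iso => //.
exact: diagram_iso_sym.
Qed.

Lemma bI_iso d d' : diagram_iso d d' -> bI d = bI d'.
Proof.
move=> iso; apply: basis_iso (iso); split; apply: is_irr_iso => //.
exact: diagram_iso_sym.
Qed.

(** * The composition of rule diagrams and its associativity *)

Lemma mulD_linearl (y : ruleD K) : linear ((@mulD K)^~ y).
Proof. exact: lin_ext_linear. Qed.

Lemma mulD_linearr (x : ruleD K) : linear (@mulD K x).
Proof.
by apply: lin_ext_fun_linear => a; apply: lin_ext_linear.
Qed.

Lemma mulD_suml (I : finType) (F : I -> ruleD K) y :
  mulD (\sum_i F i) y = \sum_i mulD (F i) y.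
Proof. exact: (lin_sum (mulD_linearl y)). Qed.

Lemma mulD_sumr (I : finType) x (F : I -> ruleD K) :
  mulD x (\sum_i F i) = \sum_i mulD x (F i).
Proof. exact: (lin_sum (mulD_linearr x)). Qed.

Lemma pull_bij_grel G H G' H' (f : (vert G -> vert G') * (edge G -> edge G'))
    (g : (vert H -> vert H') * (edge H -> edge H')) :
  bijective f.1 -> bijective f.2 -> bijective g.1 -> bijective g.2 ->
  bijective (fun m : grel G' H' => (pull f.1 g.1 m.1, pull f.2 g.2 m.2) : grel G H).
Proof.
move=> [f1 F1 F1'] [f2 F2 F2'] [g1 G1 G1'] [g2 G2 G2'].
exists (fun m : grel G H => (pull f1 g1 m.1, pull f2 g2 m.2) : grel G' H') => -[m1 m2].
  by congr pair; apply/setP=> -[x y]; rewrite !in_pull ?F1' ?F2' ?G1' ?G2'.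
by congr pair; apply/setP=> -[x y]; rewrite !in_pull ?F1 ?F2 ?G1 ?G2.
Qed.

Lemma graph_iso_gsum G H G' H' f g : @graph_iso G G' f -> @graph_iso H H' g ->
  @graph_iso (gsum G H) (gsum G' H') (summap f.1 g.1, summap f.2 g.2).
Proof.
have sb (X X' Y Y' : finType) (h : X -> X') (k : Y -> Y') :
    bijective h -> bijective k -> bijective (summap h k).
  move=> [h' H1 H2] [k' K1 K2]; exists (summap h' k') => -[z|z] /=;
  by rewrite ?H1 ?H2 ?K1 ?K2.
move=> [f1 f2 fs ft] [g1 g2 gs gt]; split=> [||[e|e]|[e|e]] /=; try exact: sb.
- by rewrite fs; case: (src e).
- by rewrite gs; case: (src e).
- by rewrite ft; case: (tgt e).
by rewrite gt; case: (tgt e).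
Qed.

(** The product is defined on chosen representatives; pulling relations back along the isomorphisms
    shows that the choice is immaterial. *)
Lemma sum_dcomp_iso A A0 B B0 : diagram_iso A A0 -> diagram_iso B B0 ->
  \sum_(m : grel (out B) (inp A)) bD (dcomp m) =
  \sum_(m : grel (out B0) (inp A0)) bD (dcomp m).
Proof.
move=> [fA [gA [fAi gAi rA mA]]] [fB [gB [fBi gBi rB mB]]].
have [fA1 fA2 _ _] := fAi; have [gB1 gB2 _ _] := gBi.
rewrite (reindex _ (onW_bij _ (pull_bij_grel gB1 gB2 fA1 fA2))) /=.
apply: eq_bigr => m _; apply: bD_iso.
exists (summap fA.1 fB.1, summap fA.2 fB.2), (summap gA.1 gB.1, summap gA.2 gB.2).
split; try exact: graph_iso_gsum.
  case: rA rB => [a1 a2] [b1 b2].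
  by split=> -[x|x] [y|y] /=; rewrite !in_rblock ?in_set0.
case: mA mB => [a1 a2] [b1 b2].
by split=> -[x|x] [y|y] /=; rewrite !in_rblock ?in_pull.
Qed.

Lemma mulD_basis A B : is_rule_diagram A -> is_rule_diagram B ->
  mulD (bD A) (bD B) = \sum_(m : grel (out B) (inp A)) bD (dcomp m).
Proof.
move=> hA hB; rewrite (basisE _ hA) (basisE _ hB) /mulD !lin_extU.
exact: sum_dcomp_iso (rep_iso hA) (rep_iso hB).
Qed.

(** The six hypotheses say that both bracketings carry the same three relations, from [B] to [A],
    from [C] to [B] and from [C] to [A]. The isomorphism only reassociates disjoint sums. *)
Lemma dcomp_assoc_iso A B C (mAB : grel (out B) (inp A)) (mBC : grel (out C) (inp B))
    (n : grel (out C) (gsum (inp A) (inp B))) (n' : grel (gsum (out B) (out C)) (inp A)) :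
  (forall b a, ((inl b, a) \in n'.1) = ((b, a) \in mAB.1)) ->
  (forall b a, ((inl b, a) \in n'.2) = ((b, a) \in mAB.2)) ->
  (forall c b, ((c, inr b) \in n.1) = ((c, b) \in mBC.1)) ->
  (forall c b, ((c, inr b) \in n.2) = ((c, b) \in mBC.2)) ->
  (forall c a, ((c, inl a) \in n.1) = ((inr c, a) \in n'.1)) ->
  (forall c a, ((c, inl a) \in n.2) = ((inr c, a) \in n'.2)) ->
  diagram_iso (@dcomp (dcomp mAB) C n) (@dcomp A (dcomp mBC) n').
Proof.
move=> b1 b2 c1 c2 a1 a2.
pose h (X Y Z : Type) (z : X + Y + Z) : X + (Y + Z) :=
  match z with
  | inl (inl x) => inl x | inl (inr y) => inr (inl y) | inr z => inr (inr z) end.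
pose h' (X Y Z : Type) (z : X + (Y + Z)) : X + Y + Z :=
  match z with
  | inl x => inl (inl x) | inr (inl y) => inl (inr y) | inr (inr z) => inr z end.
have hB (X Y Z : Type) : bijective (@h X Y Z).
  by exists (@h' X Y Z) => [[[z|z]|z]|[z|[z|z]]].
have gi (G H L : pregraph) :
    @graph_iso (gsum (gsum G H) L) (gsum G (gsum H L)) (@h _ _ _, @h _ _ _).
  split=> [||[[e|e]|e]|[[e|e]|e]]; try exact: hB.
  - by rewrite /=; case: (src e).
  - by rewrite /=; case: (src e).
  - by rewrite /=; case: (src e).
  - by rewrite /=; case: (tgt e).
  - by rewrite /=; case: (tgt e).
  by rewrite /=; case: (tgt e).
exists (@h _ _ _, @h _ _ _), (@h _ _ _, @h _ _ _); split; try exact: gi.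
  by split=> -[[x|x]|x] [[y|y]|y] /=; rewrite !in_rblock ?in_set0.
by split=> -[[x|x]|x] [[y|y]|y] /=;
  rewrite !in_rblock ?b1 ?b2 ?c1 ?c2 ?a1 ?a2.
Qed.

(** Both double sums run over triples of relations between the three diagrams. On one sort, [H] and
    [H'] regroup a triple by attaching the part from [C] to [A] either to the relation out of [C] or
    to the relation into [A]. *)
Lemma sum_dcomp_assoc A B C :
  \sum_(m : grel (out B) (inp A)) \sum_(n : grel (out C) (gsum (inp A) (inp B)))
    bD (@dcomp (dcomp m) C n) =
  \sum_(m : grel (out C) (inp B)) \sum_(n : grel (gsum (out B) (out C)) (inp A))
    bD (@dcomp A (dcomp m) n).
Proof.
rewrite !pair_big /=.
pose H (X Y Z W : finType) (p : {set Y * X} * {set Z * (X + W)}) :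
    {set Z * W} * {set (Y + Z) * X} :=
  ([set q | (q.1, inr q.2) \in p.2],
   [set q | match q.1 with inl y => (y, q.2) \in p.1 | inr z => (z, inl q.2) \in p.2 end]).
pose H' (X Y Z W : finType) (p : {set Z * W} * {set (Y + Z) * X}) :
    {set Y * X} * {set Z * (X + W)} :=
  ([set q | (inl q.1, q.2) \in p.2],
   [set q | match q.2 with inl x => (inr q.1, x) \in p.2 | inr w => (q.1, w) \in p.1 end]).
have HK X Y Z W : cancel (@H X Y Z W) (@H' X Y Z W).
  move=> [p q]; congr pair; first by apply/setP=> -[y x]; rewrite in_set /= in_set.
  by apply/setP=> -[z [x|w]]; rewrite in_set /= in_set.
have HK' X Y Z W : cancel (@H' X Y Z W) (@H X Y Z W).
  move=> [p q]; congr pair; first by apply/setP=> -[y x]; rewrite in_set /= in_set.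
  by apply/setP=> -[[y|z] x]; rewrite in_set /= in_set.
pose F (p : grel (out C) (inp B) * grel (gsum (out B) (out C)) (inp A)) :
    grel (out B) (inp A) * grel (out C) (gsum (inp A) (inp B)) :=
  let v := H' _ _ _ _ (p.1.1, p.2.1) in let e := H' _ _ _ _ (p.1.2, p.2.2) in
  ((v.1, e.1), (v.2, e.2)).
pose F' (p : grel (out B) (inp A) * grel (out C) (gsum (inp A) (inp B))) :
    grel (out C) (inp B) * grel (gsum (out B) (out C)) (inp A) :=
  let v := H _ _ _ _ (p.1.1, p.2.1) in let e := H _ _ _ _ (p.1.2, p.2.2) in
  ((v.1, e.1), (v.2, e.2)).
have FB : bijective F.
  exists F' => -[[a b] [c d]]; rewrite /F /F'.
    have := HK' _ _ _ _ (a, c); have := HK' _ _ _ _ (b, d).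
    by rewrite /H /H' /= => -[-> ->] [-> ->].
  have := HK _ _ _ _ (a, c); have := HK _ _ _ _ (b, d).
  by rewrite /H /H' /= => -[-> ->] [-> ->].
rewrite (reindex F (onW_bij _ FB)) /=; apply: eq_bigr => -[m n] _.
by apply/bD_iso/dcomp_assoc_iso => x y; rewrite in_set.
Qed.

(** If the partial composite is not a rule diagram, the left side is zero. So is every term on the
    right: by [prerule_dcomp] a full composite that is a rule diagram would make the partial one a
    [prerule], and the latter is numbered through [A] and [B]. *)
Lemma mulD_dcomp_basisl A B C (m : grel (out B) (inp A)) :
  is_rule_diagram A -> is_rule_diagram B -> is_rule_diagram C ->
  mulD (bD (dcomp m)) (bD C) =
  \sum_(n : grel (out C) (inp (dcomp m))) bD (dcomp n).
Proof.
move=> hA hB hC; case: (pselect (is_rule_diagram (dcomp m))) => hm.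
  exact: mulD_basis.
rewrite (basis0 _ hm) (lin0 (mulD_linearl _)) big1 // => n _.
apply: basis0 => /is_rule_diagramE[/prerule_dcomp[pm _ _] _]; apply: hm.
apply/is_rule_diagramE; split=> //.
have [_ n1] := (is_rule_diagramE A).1 hA; have [_ n2] := (is_rule_diagramE B).1 hB.
exact: numbered_dcomp.
Qed.

Lemma mulD_dcomp_basisr A B C (m : grel (out C) (inp B)) :
  is_rule_diagram A -> is_rule_diagram B -> is_rule_diagram C ->
  mulD (bD A) (bD (dcomp m)) =
  \sum_(n : grel (out (dcomp m)) (inp A)) bD (dcomp n).
Proof.
move=> hA hB hC; case: (pselect (is_rule_diagram (dcomp m))) => hm.
  exact: mulD_basis.
rewrite (basis0 _ hm) (lin0 (mulD_linearr _)) big1 // => n _.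
apply: basis0 => /is_rule_diagramE[/prerule_dcomp[_ pm _] _]; apply: hm.
apply/is_rule_diagramE; split=> //.
have [_ n1] := (is_rule_diagramE B).1 hB; have [_ n2] := (is_rule_diagramE C).1 hC.
exact: numbered_dcomp.
Qed.

Lemma mulDA : associative (@mulD K).
Proof.
move=> x y z; have l := mulD_linearl; have r := mulD_linearr.
apply: (eq_linear (f := fun x => mulD x (mulD y z))
                  (g := fun x => mulD (mulD x y) z)) x => [||a].
- exact: l.
- exact: linear_comp (l z) (l y).
apply: (eq_linear (f := fun y => mulD << a >> (mulD y z))
                  (g := fun y => mulD (mulD << a >> y) z)) y => [||b].
- exact: linear_comp (r _) (l z).
- exact: linear_comp (l z) (r _).
apply: (eq_linear (f := fun z => mulD << a >> (mulD << b >> z))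
                  (g := fun z => mulD (mulD << a >> << b >>) z)) z => [||c].
- exact: linear_comp (r _) (r _).
- exact: r.
rewrite -!basis_rep; move: (rep a) (rep b) (rep c) (repP a) (repP b) (repP c).
move=> A B C hA hB hC; rewrite (mulD_basis hB hC) (mulD_basis hA hB).
rewrite mulD_suml mulD_sumr.
rewrite (eq_bigr _ (fun m _ => mulD_dcomp_basisr m hA hB hC)).
rewrite [RHS](eq_bigr _ (fun m _ => mulD_dcomp_basisl m hA hB hC)).
exact/esym/sum_dcomp_assoc.
Qed.

(** * The reduction morphism on basis diagrams *)

Lemma reduct_id bI bO d : is_irr d -> reduct bI bO d d.
Proof.
move=> [[_ gI gO] m0]; exists id, id, id, id; split=> //.
- have sI : sideI d = rid _.
    by rewrite /sideI m0; have [-> _ _ _] := traj_m0 (rr d).1.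
  rewrite sI; split=> // [v|e|b x v].
  + split=> [_|_]; last by exists v.
    by rewrite /freeIV m0; apply/rimP => -[x]; rewrite in_set0.
  + split=> [_|_]; last by exists e.
    split=> [|_ b]; first by rewrite /freeIE m0; apply/rimP => -[x]; rewrite in_set0.
    have [v hv] := (is_graphP _).1 gI e b; exists v, v; split=> //; last by rewrite in_rid.
    by rewrite /freeIV m0; apply/rimP => -[x]; rewrite in_set0.
  split=> [->|[u -> /[!in_rid]/eqP ->]] //; by exists v; rewrite ?in_rid.
- have sO : sideO d = rid _.
    rewrite /sideO m0; have [_ -> _ _] := traj_m0 (rr d).1.
    by apply/setP=> -[x y]; rewrite in_rconv !in_rid eq_sym.
  rewrite sO; split=> // [v|e|b x v].
  + split=> [_|_]; last by exists v.
    by rewrite /freeOV m0; apply/rdomP => -[x]; rewrite in_set0.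
  + split=> [_|_]; last by exists e.
    split=> [|_ b]; first by rewrite /freeOE m0; apply/rdomP => -[x]; rewrite in_set0.
    have [v hv] := (is_graphP _).1 gO e b; exists v, v; split=> //; last by rewrite in_rid.
    by rewrite /freeOV m0; apply/rdomP => -[x]; rewrite in_set0.
  split=> [->|[u -> /[!in_rid]/eqP ->]] //; by exists v; rewrite ?in_rid.
- rewrite m0; have [_ _ -> _] := traj_m0 (rr d).1.
  by apply/setP=> -[x y]; rewrite in_pull.
rewrite m0; have [_ _ -> _] := traj_m0 (rr d).2.
by apply/setP=> -[x y]; rewrite in_pull.
Qed.

Lemma reduct_graph bI bO d d' : reduct bI bO d d' ->
  (is_graph (inp d') <-> bI \/ no_dangling (freeIV d) (freeIE d) (sideI d)) /\
  (is_graph (out d') <-> bO \/ no_dangling (freeOV d) (freeOE d) (sideO d)).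
Proof.
by move=> [iV [iE [oV [oE [jI jO _ _ _]]]]]; split; [apply: bside_graph jI|apply: bside_graph jO].
Qed.

Lemma reduct_true bI bO d d' : reduct bI bO d d' ->
  is_graph (inp d') -> is_graph (out d') -> reduct true true d d'.
Proof.
move=> [iV [iE [oV [oE [jI jO hV hE m0]]]]] gI gO; exists iV, iE, oV, oE; split=> //.
  exact: bside_true jI gI.
exact: bside_true jO gO.
Qed.

Lemma reduct_rule d : is_rule_diagram d -> reduct false false d (bdry d).
Proof. by move=> [[[r1 _] m1 _ _] _ _]; apply: reduct_bdry. Qed.

Lemma reduct_irr d : is_rule_diagram d -> exists2 d', reduct true true d d' & is_irr d'.
Proof.
move=> hd; have red := reduct_spoA (reduct_spoB (reduct_rule hd)).
exists (spoA (spoB (bdry d))); first exact: red.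
have [[_ gI] [_ gO]] := reduct_graph red.
apply: is_irr_prediagram; [|by apply: gI; left|by apply: gO; left].
exact/is_irr_pre_spoA/is_irr_pre_spoB/is_irr_pre_bdry.
Qed.

Definition deletes_inp (T : semantics) : bool :=
  match T with SPO_B | SPO_AB => true | _ => false end.

Definition deletes_out (T : semantics) : bool :=
  match T with SPO_A | SPO_AB => true | _ => false end.

(* [phi T d] does not vanish. *)
Definition clean (T : semantics) (d : diagram) : Prop :=
  (deletes_inp T \/ no_dangling (freeIV d) (freeIE d) (sideI d)) /\
  (deletes_out T \/ no_dangling (freeOV d) (freeOE d) (sideO d)).

Lemma bdryD_basis A : is_rule_diagram A ->
  exists2 x, bdryD (bD A) = << x >> & reduct false false A (rep x).
Proof.
move=> hA; exists (mkclass (is_irr_pre_bdry (repP (mkclass hA)))).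
  by rewrite (basisE _ hA) /bdryD lin_extU.
apply: reduct_isor (diagram_iso_sym (rep_iso _)) _.
exact: (reduct_isol (rep_iso hA) (reduct_rule (repP _))).
Qed.

Lemma fspoA_basis bI bO A x : reduct bI bO A (rep x) ->
  exists2 y, @fspoA K << x >> = << y >> & reduct bI true A (rep y).
Proof.
move=> h; exists (mkclass (is_irr_pre_spoA (repP x))); first by rewrite /fspoA lin_extU.
apply: reduct_isor (diagram_iso_sym (rep_iso _)) _; exact: reduct_spoA h.
Qed.

Lemma fspoB_basis bI bO A x : reduct bI bO A (rep x) ->
  exists2 y, @fspoB K << x >> = << y >> & reduct true bO A (rep y).
Proof.
move=> h; exists (mkclass (is_irr_pre_spoB (repP x))); first by rewrite /fspoB lin_extU.
apply: reduct_isor (diagram_iso_sym (rep_iso _)) _; exact: reduct_spoB h.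
Qed.

(** The flags record which deletions have already been applied to reach [x]. Once [rep x] passes the
    graph test it is itself a full reduction of [A], hence isomorphic to [X]. *)
Lemma projP_basis delI delO A X x : reduct delI delO A (rep x) -> reduct true true A X ->
  let ok := (delI \/ no_dangling (freeIV A) (freeIE A) (sideI A)) /\
            (delO \/ no_dangling (freeOV A) (freeOE A) (sideO A)) in
  (ok -> @projP K << x >> = bI X) /\ (~ ok -> @projP K << x >> = 0).
Proof.
move=> h hX; have [gI gO] := reduct_graph h.
rewrite /projP lin_extU; case: pselect => g; split=> [[/gI g1 /gO g2]|nok] //.
- rewrite -(bI_iso (reduct_uniq (reduct_true h g1 g2) hX)).
  by rewrite (basisE _ (is_irr_prediagram (repP x) g.1 g.2)).
- by case: nok; split; [apply/gI/g.1|apply/gO/g.2].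
by case: g.
Qed.

Lemma phi_basis T A X : is_rule_diagram A -> reduct true true A X ->
  (clean T A -> phi T (bD A) = bI X) /\ (~ clean T A -> phi T (bD A) = 0).
Proof.
move=> hA hX; have [x ex hx] := bdryD_basis hA; rewrite /phi /=; rewrite ex.
case: T => /=.
- exact: projP_basis hx hX.
- by have [y -> hy] := fspoA_basis hx; apply: projP_basis hy hX.
- by have [y -> hy] := fspoB_basis hx; apply: projP_basis hy hX.
have [y -> hy] := fspoB_basis hx; have [z -> hz] := fspoA_basis hy.
exact: projP_basis hz hX.
Qed.

Lemma phi_linear T : linear (@phi K T).
Proof.
apply: linear_comp; last exact: lin_ext_linear.
case: T; [|apply: linear_comp|apply: linear_comp|apply: linear_comp; first apply: linear_comp];
  exact: lin_ext_linear.
Qed.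

Lemma psi_linear : linear (@psi K).
Proof. exact: lin_ext_linear. Qed.

Lemma psi_basis X : is_irr X -> psi (bI X) = bD X.
Proof.
move=> hX; rewrite (basisE _ hX) /psi lin_extU -(basisE _ (is_irr_rule (repP _))).
exact/bD_iso/rep_iso.
Qed.

(** Without any deletion, [X] is its own boundary by [reduct_id], and it consists of graphs. *)
Lemma clean_irr T X : is_irr X -> clean T X.
Proof.
move=> hX; have [[gI _] [gO _]] := reduct_graph (reduct_id false false hX).
by have [[_ hI hO] _] := hX; split; right; [case: (gI hI)|case: (gO hO)].
Qed.

Lemma phi_psi T : cancel (@psi K) (phi T).
Proof.
apply: (eq_linear (f := fun x : irrD K => phi T (psi x)) (g := id)) => [||x].
- exact: linear_comp (phi_linear T) psi_linear.
- by [].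
rewrite -basis_rep (psi_basis (repP x)).
apply: (phi_basis T (is_irr_rule (repP x)) (reduct_id _ _ (repP x))).1.
exact: clean_irr (repP x).
Qed.

(** Distributes a deletion flag, which depends only on [T], over the three conditions of
    [no_dangling_inp] and [no_dangling_out]. *)
Lemma or_and3 (b : bool) (P Q R : Prop) :
  (b \/ [/\ P, Q & R]) <-> [/\ b \/ P, b \/ Q & b \/ R].
Proof.
split=> [[hb|[p q r]]|[[hb|p] [hb'|q] [hb''|r]]];
  by [split; left|split; right|left|right].
Qed.

Lemma clean_dcomp T A B A' B' iVA iEA oVA oEA iVB iEB oVB oEB
    (RA : @reduction true true A A' iVA iEA oVA oEA)
    (RB : @reduction true true B B' iVB iEB oVB oEB) (m : grel (out B) (inp A)) :
  prerule A -> prerule B -> matching m ->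
  clean T (dcomp m) <->
  [/\ clean T A, clean T B & clean T (dcomp (restrict iVA iEA oVB oEB m))].
Proof.
move=> pA pB hm; rewrite /clean.
rewrite (no_dangling_inp RA RB pA pB hm) (no_dangling_out RA RB pA pB hm).
by rewrite !or_and3; split=> [[[? ? ?] [? ? ?]]|[[? ?] [? ?] [? ?]]].
Qed.

Lemma phi_mulD_basis T A B : is_rule_diagram A -> is_rule_diagram B ->
  phi T (mulD (bD A) (bD B)) = mulR T (phi T (bD A)) (phi T (bD B)).
Proof.
move=> hA hB; have [A' redA hA'] := reduct_irr hA; have [B' redB hB'] := reduct_irr hB.
have [phiA phiA0] := phi_basis T hA redA; have [phiB phiB0] := phi_basis T hB redB.
have [iVA [iEA [oVA [oEA RA]]]] := redA; have [iVB [iEB [oVB [oEB RB]]]] := redB.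
have [pA _] := (is_rule_diagramE A).1 hA; have [pB _] := (is_rule_diagramE B).1 hB.
rewrite (mulD_basis hA hB) (lin_sum (phi_linear T)) /mulR.
(* Case of an unclean factor: no composite is clean, so every term on the left is zero, as is the
   image of that factor on the right. *)
have phi0 : ~ (clean T A /\ clean T B) ->
    \sum_(m : grel (out B) (inp A)) phi T (bD (dcomp m)) = 0.
  move=> nok; apply: big1 => m _; case: (pselect (is_rule_diagram (dcomp m))) => h.
    have [X redX _] := reduct_irr h; apply: (phi_basis T h redX).2.
    move: (h) => /(is_rule_diagram_dcomp _ hA hB) hm.
    by move=> /(clean_dcomp T RA RB pA pB hm)[cA cB _]; apply: nok.
  by rewrite (basis0 _ h) (lin0 (phi_linear T)).
case: (pselect (clean T A)) => cA; last first.
  rewrite phi0; last by case.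
  by rewrite (phiA0 cA) (lin0 psi_linear) (lin0 (mulD_linearl _)) (lin0 (phi_linear T)).
case: (pselect (clean T B)) => cB; last first.
  rewrite phi0; last by case.
  by rewrite (phiB0 cB) (lin0 psi_linear) (lin0 (mulD_linearr _)) (lin0 (phi_linear T)).
rewrite (phiA cA) (phiB cB) (psi_basis hA') (psi_basis hB').
have rA' := is_irr_rule hA'; have rB' := is_irr_rule hB'.
rewrite (mulD_basis rA' rB') (lin_sum (phi_linear T)).
pose P (m : grel (out B) (inp A)) := `[< matching m >].
pose P' (m : grel (out B') (inp A')) := `[< matching m >].
have zero C D (hC : is_rule_diagram C) (hD : is_rule_diagram D)
    (m : grel (out D) (inp C)) : ~~ `[< matching m >] -> phi T (bD (dcomp m)) = 0.
  move=> /asboolP nm; rewrite basis0 ?(lin0 (phi_linear T)) //.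
  by move=> /(is_rule_diagram_dcomp _ hC hD).
(* Relations that are not matchings contribute zero on both sides; the remaining terms correspond
   under [extend] and [restrict], which are mutually inverse on matchings. *)
rewrite (bigID P) /= [X in _ + X]big1 ?addr0; last by move=> m; apply: zero.
rewrite [RHS](bigID P') /= [X in _ = _ + X]big1 ?addr0; last by move=> m; apply: zero.
rewrite (reindex_onto (extend iVA iEA oVB oEB) (restrict iVA iEA oVB oEB)); last first.
  by move=> m /asboolP; apply: (restrictK RA RB).
apply: eq_big => [m|m].
  rewrite (extendK RA RB) eqxx andbT; apply/asboolP/asboolP => [hm|].
    by have := matching_restrict RA RB pA pB hm; rewrite (extendK RA RB).
  exact: matching_extend RA RB pA pB m.
rewrite (extendK RA RB) eqxx andbT => /asboolP hm.
have hm' := matching_restrict RA RB pA pB hm; move: (hm'); rewrite (extendK RA RB) => hm''.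
have hD := (is_rule_diagram_dcomp _ hA hB).2 hm.
have hD' := (is_rule_diagram_dcomp _ rA' rB').2 hm''.
(* [X] is the full reduction of the composite of [A'] and [B'], and by [reduct_dcomp] also of the
   composite of [A] and [B]. As [A] and [B] are clean, the two composites are clean together, so
   both terms are [bI X] or both are zero. *)
have [X redX _] := reduct_irr hD'.
have redX' : reduct true true (dcomp (extend iVA iEA oVB oEB m)) X.
  by apply: (reduct_dcomp RA RB pA pB hm); rewrite (extendK RA RB).
have := clean_dcomp T RA RB pA pB hm; rewrite (extendK RA RB) => cE.
have [p1 p0] := phi_basis T hD redX'; have [p1' p0'] := phi_basis T hD' redX.
case: (pselect (clean T (dcomp m))) => c.
  by rewrite p1 ?p1' //; apply/cE.
by rewrite p0 ?p0' // => /cE[].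
Qed.

Lemma mulR_linearl T (y : irrD K) : linear ((@mulR K T)^~ y).
Proof.
exact: linear_comp (linear_comp (phi_linear T) (mulD_linearl (psi y))) psi_linear.
Qed.

Lemma mulR_linearr T (x : irrD K) : linear (@mulR K T x).
Proof.
exact: linear_comp (linear_comp (phi_linear T) (mulD_linearr (psi x))) psi_linear.
Qed.

Lemma phi_mulD T (d1 d2 : ruleD K) : phi T (mulD d1 d2) = mulR T (phi T d1) (phi T d2).
Proof.
have pl := phi_linear T.
apply: (eq_linear (f := fun x : ruleD K => phi T (mulD x d2))
                  (g := fun x : ruleD K => mulR T (phi T x) (phi T d2))) d1 => [||a].
- exact: linear_comp pl (mulD_linearl d2).
- exact: linear_comp (mulR_linearl T _) pl.
apply: (eq_linear (f := fun y : ruleD K => phi T (mulD << a >> y))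
                  (g := fun y : ruleD K => mulR T (phi T << a >>) (phi T y))) d2 => [||b].
- exact: linear_comp pl (mulD_linearr _).
- exact: linear_comp (mulR_linearr T _) pl.
rewrite -!basis_rep; exact: phi_mulD_basis (repP a) (repP b).
Qed.

Lemma mulRA T : associative (@mulR K T).
Proof.
move=> x y z; rewrite -[x](phi_psi T) -[y](phi_psi T) -[z](phi_psi T).
move: (psi x) (psi y) (psi z) => u v w.
have l := etrans (phi_mulD T u (mulD v w)) (congr1 (mulR T (phi T u)) (phi_mulD T v w)).
have r := etrans (phi_mulD T (mulD u v) w)
  (congr1 (fun z => mulR T z (phi T w)) (phi_mulD T u v)).
exact (etrans (esym l) (etrans (congr1 (phi T) (mulDA u v w)) r)).
Qed.

(** * The unit *)

Lemma graph_iso_gsum0r G :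
  @graph_iso G (gsum G gempty) (inl, inl).
Proof.
have iB (X : Type) : bijective (@inl X void).
  by exists (fun z => match z with inl x => x | inr v => of_void X v end) => // -[|[]].
by split=> [||e|e]; do ?exact: iB.
Qed.

Lemma graph_iso_gsum0l G :
  @graph_iso G (gsum gempty G) (inr, inr).
Proof.
have iB (X : Type) : bijective (@inr void X).
  by exists (fun z => match z with inr x => x | inl v => of_void X v end) => // -[[]|].
by split=> [||e|e]; do ?exact: iB.
Qed.

Lemma dcomp_dempty_r A (m : grel (out dempty) (inp A)) : diagram_iso A (dcomp m).
Proof.
exists (inl, inl), (inl, inl); split; do ?exact: graph_iso_gsum0r.
  by split=> x y; rewrite in_rblock.
by split=> x y; rewrite in_rblock.
Qed.

Lemma dcomp_dempty_l A (m : grel (out A) (inp dempty)) : diagram_iso A (dcomp m).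
Proof.
exists (inr, inr), (inr, inr); split; do ?exact: graph_iso_gsum0l.
  by split=> x y; rewrite in_rblock.
by split=> x y; rewrite in_rblock.
Qed.

Lemma mulD_dempty_l A : is_rule_diagram A -> mulD (bD dempty) (bD A) = bD A.
Proof.
move=> hA; rewrite (mulD_basis (is_irr_rule is_irr_dempty) hA).
(* [dempty] has no vertices and no edges, so the empty relation is the only summation index. *)
rewrite (big_pred1 (grel0 _ _)) => [|[m1 m2]]; last first.
  by apply/esym/eqP; congr pair; apply/setP=> -[? []].
exact/esym/bD_iso/dcomp_dempty_l.
Qed.

Lemma mulD_dempty_r A : is_rule_diagram A -> mulD (bD A) (bD dempty) = bD A.
Proof.
move=> hA; rewrite (mulD_basis hA (is_irr_rule is_irr_dempty)).
rewrite (big_pred1 (grel0 _ _)) => [|[m1 m2]]; last first.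
  by apply/esym/eqP; congr pair; apply/setP=> -[[]].
exact/esym/bD_iso/dcomp_dempty_r.
Qed.

Lemma psi_unit : psi (unit_irr K) = bD dempty.
Proof. by rewrite -(psi_basis is_irr_dempty) (basisE _ is_irr_dempty). Qed.

Lemma mulR1l T : left_id (unit_irr K) (@mulR K T).
Proof.
apply: (eq_linear (f := mulR T (unit_irr K)) (g := id)) => [||x]; first exact: mulR_linearr.
  by [].
have hx := repP x.
by rewrite -basis_rep /mulR psi_unit (psi_basis hx) (mulD_dempty_l (is_irr_rule hx))
  -(psi_basis hx) phi_psi.
Qed.

Lemma mulR1r T : right_id (unit_irr K) (@mulR K T).
Proof.
apply: (eq_linear (f := fun x : irrD K => mulR T x (unit_irr K)) (g := id)) => [||x].
- exact: mulR_linearl.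
- by [].
have hx := repP x.
by rewrite -basis_rep /mulR psi_unit (psi_basis hx) (mulD_dempty_r (is_irr_rule hx))
  -(psi_basis hx) phi_psi.
Qed.

End RuleAlgebraProof.

Theorem theorem2p2 (K : fieldType) (T : semantics) :
  (linear (@phi K T) /\
   forall d1 d2 : ruleD K,
     phi T (mulD d1 d2) = mulR T (phi T d1) (phi T d2)) /\
  assoc_unital_algebra (@mulR K T) (unit_irr K).
Proof.
split; first by split; [apply: phi_linear|apply: phi_mulD].
split; [exact: mulR_linearr|exact: mulR_linearl|exact: mulRA|exact: mulR1l|exact: mulR1r].
Qed.
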